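(* Let $F$ be a free group of finite rank $k\ge2$ with a fixed free basis $\Sigma$. Then the set $\{L(\Phi):\Phi\in\mathrm{Aut}(F)\}$ of lengths of automorphisms of $F$ is a discrete subset of $\mathbb R$.
   Context: Let $A=\Sigma\cup\Sigma^{-1}$; elements of $F$ are identified with freely reduced words in $A$, and $|v|$ is the word length. $\partial F$ is the space of right-infinite freely reduced words in $A$ (geodesic rays from $1$ in the Cayley graph of $F$ with respect to $A$); for $v\in F$, $\mathrm{Cyl}(v)\subset\partial F$ is the set of rays having $v$ as initial segment ($\mathrm{Cyl}(1)=\partial F$), and these sets form a basis of the topology. $\partial^2F=\{(x,y)\in\partial F\times\partial F: x\ne y\}$ is identified with the set of oriented bi-infinite geodesics of the Cayley graph; $B\subset\partial^2F$ is the set of geodesics passing through the vertex $1$; for $x\neq y\in F$, $\mathrm{Cyl}([x,y])\subset\partial^2F$ is the set of geodesics passing through the oriented segment from $x$ to $y$ (with the correct orientation), and $\mathrm{Cyl}([1,1])=B$. $F$ acts on $\partial F$ by left translation and diagonally on $\partial^2F$. Every $\Phi\in\mathrm{Aut}(F)$ extends to a homeomorphism of $\partial F$, still denoted $\Phi$. A geodesic current is a locally finite $F$-invariant non-negative Borel measure on $\partial^2F$; for a current $\eta$ one writes $\Phi\eta=(\Phi\times\Phi)_*\eta$, and the length of $\eta$ is $L(\eta)=\eta(B)$. The uniform current $\eta_A$ is the geodesic current determined by $\eta_A(\mathrm{Cyl}([x,y]))=\frac{1}{2k(2k-1)^{|x^{-1}y|-1}}$ for all $x\ne y$ in $F$.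 The length of $\Phi\in\mathrm{Aut}(F)$ is $L(\Phi)=L(\Phi\eta_A)=\eta_A\big((\Phi\times\Phi)^{-1}(B)\big)$. *)

(* Defs.v *)
From HB Require Import structures.
From mathcomp Require Import all_boot all_order all_algebra.
From mathcomp Require Import all_classical all_reals all_analysis.
Import Order.TTheory GRing.Theory Num.Theory numFieldNormedType.Exports.

Set Implicit Arguments.
Unset Strict Implicit.
Unset Printing Implicit Defensive.

Local Open Scope classical_set_scope.
Local Open Scope ring_scope.
Local Open Scope group_scope.

(* The free group on a finite set S is modelled by the freely reduced words
   over letter S = S + S^-1, where (s, true) stands for s and (s, false) for
   s^-1. *)
Notation letter S := (S * bool)%type.

Definition linv (S : finType) (a : letter S) : letter S := (a.1, ~~ a.2).

Definition reduced (S : finType) (w : seq (letter S)) : bool :=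
  sorted (fun a b => b != linv a) w.

Record free_group (S : finType) := FreeWord {
  word :> seq (letter S);
  word_reduced : reduced word
}.
HB.instance Definition _ (S : finType) := [isSub for @word S].
HB.instance Definition _ (S : finType) := [Choice of free_group S by <:].

Section FreeGroup.
Variable S : finType.
Implicit Types (a b : letter S) (w u v : seq (letter S)).

Lemma linvK : involutive (@linv S).
Proof. by case=> s b; rewrite /linv /= negbK. Qed.

(* the reduced form of a w, when w is reduced *)
Definition red_cons a w : seq (letter S) :=
  if w is b :: w' then (if b == linv a then w' else a :: w) else [:: a].

Lemma red_cons_reduced a w : reduced w -> reduced (red_cons a w).
Proof.
case: w => [|b w] //= rw; case: ifPn => [_|nb]; first exact: path_sorted rw.
by rewrite /= nb.
Qed.

Lemma red_consK a w : reduced w -> red_cons (linv a) (red_cons a w) = w.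
Proof.
case: w => [|b w] /=; first by rewrite linvK eqxx.
case: eqVneq => [->|nb _] /=; last by rewrite linvK eqxx.
by case: w => [|c w] //= /andP[/negPf -> _].
Qed.

Definition red_cat u v : seq (letter S) := foldr red_cons v u.

Lemma red_cat_reduced u v : reduced v -> reduced (red_cat u v).
Proof. by move=> rv; elim: u => //= a u IHu; exact: red_cons_reduced. Qed.

Lemma red_cat0 u : reduced u -> red_cat u [::] = u.
Proof.
elim: u => //= a u IHu ru; rewrite IHu; last exact: path_sorted ru.
by case: u ru {IHu} => //= b u /andP[/negPf ->].
Qed.

Lemma red_cat_cons a u v : reduced u -> reduced v ->
  red_cat (red_cons a u) v = red_cons a (red_cat u v).
Proof.
case: u => [|b u] //= ru rv; case: eqVneq => //= ->.
by rewrite -[in RHS](linvK a) linvK -{1}(linvK a) red_consK ?red_cat_reduced.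
Qed.

Lemma red_catA u v w : reduced u -> reduced v -> reduced w ->
  red_cat u (red_cat v w) = red_cat (red_cat u v) w.
Proof.
move=> ru rv rw; elim: u ru => //= a u IHu ru.
rewrite -!/(red_cat _ _) IHu; last exact: path_sorted ru.
by rewrite red_cat_cons// red_cat_reduced.
Qed.

Definition word_inv w : seq (letter S) := rev (map (@linv S) w).

Lemma word_inv_reduced w : reduced w -> reduced (word_inv w).
Proof.
rewrite /reduced /word_inv rev_sorted sorted_map => /sub_sorted; apply.
by move=> a b /=; apply: contraNN => /eqP ->; rewrite linvK.
Qed.

Lemma red_catVw w v : reduced v -> red_cat (word_inv w) (red_cat w v) = v.
Proof.
move=> rv; elim: w => //= a w IHw.
rewrite /word_inv /= rev_cons /red_cat foldr_rcons red_consK//.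
exact: red_cat_reduced.
Qed.

Definition fg_one : free_group S := FreeWord (isT : reduced [::]).

Definition fg_mul (x y : free_group S) : free_group S :=
  FreeWord (red_cat_reduced x (word_reduced y)).

Definition fg_inv (x : free_group S) : free_group S :=
  FreeWord (word_inv_reduced (word_reduced x)).

Lemma fg_mulA : associative fg_mul.
Proof. by move=> x y z; apply: val_inj; rewrite /= red_catA ?word_reduced. Qed.

Lemma fg_mul1 : left_id fg_one fg_mul.
Proof. by move=> x; exact: val_inj. Qed.

Lemma fg_mulr1 : right_id fg_one fg_mul.
Proof. by move=> x; apply: val_inj; rewrite /= red_cat0 ?word_reduced. Qed.

Lemma fg_mulV : left_inverse fg_one fg_inv fg_mul.
Proof.
by move=> x; apply: val_inj => /=; rewrite -{2}(red_cat0 (word_reduced x)) red_catVw.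
Qed.

Lemma fg_mulrV : right_inverse fg_one fg_inv fg_mul.
Proof.
move=> x; have vv : fg_inv (fg_inv x) = x.
  apply: val_inj => /=.
  by rewrite /word_inv map_rev revK mapK //; exact: linvK.
by rewrite -{1}vv fg_mulV.
Qed.

End FreeGroup.

HB.instance Definition _ (S : finType) := isGroup.Build (free_group S)
  (@fg_mulA S) (@fg_mul1 S) (@fg_mulr1 S) (@fg_mulV S) (@fg_mulrV S).
HB.instance Definition _ (S : finType) := isPointed.Build (free_group S) 1.

Definition wlen (S : finType) (x : free_group S) : nat := size x.
Definition wdist (S : finType) (x y : free_group S) : nat := wlen (x^-1 * y).

Record boundary (S : finType) := Ray {
  ray :> nat -> letter S;
  ray_reduced : forall n, ray n.+1 != linv (ray n)
}.
HB.instance Definition _ (S : finType) := gen_eqMixin (boundary S).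
HB.instance Definition _ (S : finType) := gen_choiceMixin (boundary S).

Definition cyl (S : finType) (v : free_group S) : set (boundary S) :=
  [set xi | mkseq xi (size v) = v].

Section BoundaryTopology.
Variable S : finType.

Lemma cyl_cover : \bigcup_(v in [set: free_group S]) cyl v = setT.
Proof. by apply/seteqP; split => // xi _; exists (fg_one S). Qed.

Lemma cyl_join (u v : free_group S) (xi : boundary S) :
  [set: free_group S] u -> [set: free_group S] v -> cyl u xi -> cyl v xi ->
  exists w, [/\ [set: free_group S] w, cyl w xi & cyl w `<=` cyl u `&` cyl v].
Proof.
have take_mkseq (f : nat -> letter S) m n :
    (m <= n)%N -> mkseq f m = take m (mkseq f n).
  by move=> mn; rewrite /mkseq -map_take take_iota (minn_idPl mn).
move=> _ _; have [uv|/ltnW vu] := leqP (size u) (size v) => xu xv.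
  exists v; split => // eta ev; split => //; move: xu xv ev.
  by rewrite /cyl /= !(take_mkseq _ _ _ uv) => + xv ev; rewrite xv ev.
exists u; split => // eta eu; split => //; move: xu xv eu.
by rewrite /cyl /= !(take_mkseq _ _ _ vu) => xu + eu; rewrite xu eu.
Qed.

End BoundaryTopology.

HB.instance Definition _ (S : finType) :=
  isBaseTopological.Build (boundary S) (@cyl_cover S) (@cyl_join S).

(* convergence of a sequence of group elements to a boundary point, in the
   compactification of the Cayley tree by its boundary *)
Definition tends_to (S : finType) (u : nat -> free_group S) (xi : boundary S) :=
  forall m : nat, \forall n \near \oo, prefix (mkseq xi m) (u n).

Section Prefix.
Variables (S : finType) (xi : boundary S).

Lemma ray_prefix_reduced n : reduced (mkseq xi n).
Proof.
apply/(sortedP (xi 0)) => i; rewrite size_mkseq => ilt.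
by rewrite !nth_mkseq ?(ltnW ilt)//; exact: ray_reduced.
Qed.

Definition ray_prefix n : free_group S := FreeWord (ray_prefix_reduced n).

End Prefix.

(* The continuous extension to the boundary of f : F -> F: the point xi is sent
   to the limit of f along the vertices of the ray xi.  The limit exists when f
   is a left translation or an automorphism; the default value xi of xget
   only serves to make the definition total. *)
Definition extend (S : finType) (f : free_group S -> free_group S)
    (xi : boundary S) : boundary S :=
  xget xi [set eta | tends_to (f \o ray_prefix xi) eta].

Definition boundary2 (S : finType) : Type :=
  set_type [set p : boundary S * boundary S | p.1 != p.2].
HB.instance Definition _ (S : finType) := Topological.on (boundary2 S).
HB.instance Definition _ (S : finType) := SubType.on (boundary2 S).

(* The map f x f on the double boundary.  For an injective f (in particular for
   the extension of a translation or an automorphism) the default value p of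
   insubd is never used. *)
Definition diag (S : finType) (f : boundary S -> boundary S)
    (p : boundary2 S) : boundary2 S :=
  insubd p (f (val p).1, f (val p).2).

Definition geodesic (S : finType) (gam : int -> free_group S) : Prop :=
  forall m n : int, wdist (gam m) (gam n) = `|m - n|%N.

(* gam is a geodesic, oriented from (val p).1 to (val p).2 *)
Definition geodesic_of (S : finType) (p : boundary2 S)
    (gam : int -> free_group S) : Prop :=
  [/\ geodesic gam,
      tends_to (fun n : nat => gam (- n%:Z)%R) (val p).1 &
      tends_to (fun n : nat => gam (n%:Z)%R) (val p).2].

Definition through1 (S : finType) : set (boundary2 S) :=
  [set p | exists2 gam, geodesic_of p gam & exists s, gam s = 1].
Arguments through1 S : clear implicits.

Definition cyl2 (S : finType) (x y : free_group S) : set (boundary2 S) :=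
  [set p | exists2 gam, geodesic_of p gam &
    exists s t : int, [/\ (s <= t)%R, gam s = x & gam t = y]].

(* Measurable spaces are required to be nonempty: hS provides a base point. *)
Definition boundary2p (S : finType) (hS : (2 <= #|S|)%N) : Type := boundary2 S.
HB.instance Definition _ (S : finType) (hS : (2 <= #|S|)%N) :=
  Topological.on (boundary2p hS).

Section Point.
Variables (S : finType) (hS : (2 <= #|S|)%N).

Let const_ray_reduced (a : letter S) (n : nat) : a != linv a.
Proof. by case: a => s []; apply/eqP => -[]. Qed.

Let const_ray (a : letter S) : boundary S :=
  @Ray S (fun=> a) (const_ray_reduced a).

Let boundary2p_inhabited : exists p : boundary2p hS, True.
Proof.
have /card_gt0P[s _] : (0 < #|S|)%N by exact: ltnW.
suff st : const_ray (s, true) != const_ray (s, false).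
  by exists (exist _ (_, _) (mem_set st)).
by apply/eqP => /(congr1 (fun xi : boundary S => xi 0)).
Qed.

HB.instance Definition _ :=
  isPointed.Build (boundary2p hS) (sval (cid boundary2p_inhabited)).

End Point.

Definition borel2 (S : finType) (hS : (2 <= #|S|)%N) :=
  g_sigma_algebraType (@open (boundary2p hS)).

Section Currents.
Variables (R : realType) (S : finType) (hS : (2 <= #|S|)%N).
Local Open Scope ereal_scope.

(* the image measure under f x f, where f is extended to the boundary *)
Definition push_current (f : free_group S -> free_group S)
    (eta : set (borel2 hS) -> \bar R) : set (borel2 hS) -> \bar R :=
  pushforward eta (diag (extend f) : borel2 hS -> borel2 hS).

Definition geodesic_current
    (eta : {measure set (borel2 hS) -> \bar R}) : Prop :=
  (forall p : boundary2p hS, exists U : set (boundary2p hS),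
    [/\ open U, U p & eta U < +oo]) /\
  (forall (g : free_group S) (A : set (borel2 hS)), measurable A ->
    push_current (fun x => (g * x)%g) eta A = eta A).

Definition uniform_current
    (eta : {measure set (borel2 hS) -> \bar R}) : Prop :=
  geodesic_current eta /\
  forall x y : free_group S, x != y ->
    eta (cyl2 x y) =
      ((2 * #|S|%:R * (2 * #|S|%:R - 1) ^+ (wdist x y).-1)^-1)%R%:E.

Definition current_length (eta : set (borel2 hS) -> \bar R) : \bar R :=
  eta (through1 S).

End Currents.

Definition Aut (S : finType) :
    set {multiplicative free_group S -> free_group S} :=
  [set Phi | bijective Phi].
Arguments Aut S : clear implicits.

Definition aut_length (R : realType) (S : finType) (hS : (2 <= #|S|)%N)
    (etaA : {measure set (borel2 hS) -> \bar R})
    (Phi : {multiplicative free_group S -> free_group S}) : \bar R :=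
  current_length (push_current Phi etaA).

(* Main.v *)
Require Import Defs.
From HB Require Import structures.
From mathcomp Require Import all_boot all_order all_algebra.
From mathcomp Require Import all_classical all_reals all_analysis.
From mathcomp Require Import zify lra.
Import Order.TTheory GRing.Theory Num.Theory numFieldNormedType.Exports.
Local Open Scope classical_set_scope.
Local Open Scope ring_scope.

Set Implicit Arguments.
Unset Strict Implicit.
Unset Printing Implicit Defensive.

(* For each C, only finitely many automorphisms Phi, up to conjugation, have
   length at most C; as the length is invariant under conjugation, this leaves
   finitely many values below C.  The finiteness is an energy argument.  For a
   letter a let K_a be the set of ends mapped by Phi to rays starting with a.
   The harmonic measure g |-> nu_g(K_a), seen from the vertices g of the Cayley
   tree, has Dirichlet energy comparable to eta_A(K_a^c x K_a), hence at most
   const L(Phi) (Douglas' formula).  The variance nu_g(K_a)(1 - nu_g(K_a)) is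
   bounded by the energy located near g, up to a geometrically small tail, so
   the number of pairs (g, a) with nu_g(K_a)(1 - nu_g(K_a)) >= kappa is bounded
   in terms of L(Phi) and kappa.  Now take a vertex t with nu_t(K_b) <= 1/2 for
   all letters b.  The edges of the target tree crossed by the geodesic from 1 to
   w = Phi(t s t^-1), where s is a letter, all give such pairs with
   kappa = 1/(4(2k-1)), so |w| is bounded. *)

(** * Reduced words *)

Section CommonPrefix.
Variable T : eqType.
Implicit Types s t u : seq T.

Fixpoint lcp s t : nat :=
  match s, t with
  | x :: s', y :: t' => if x == y then (lcp s' t').+1 else 0
  | _, _ => 0
  end.

Lemma leq_lcp m s t :
  (m <= lcp s t)%N = [&& m <= size s, m <= size t & take m s == take m t]%N.
Proof.
elim: s t m => [|x s IHs] [|y t] [|m] //=; first by rewrite andbF.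
have [<-|nxy] := eqVneq x y.
  by rewrite ltnS IHs !ltnS eqseq_cons eqxx.
by rewrite eqseq_cons (negPf nxy) !andbF.
Qed.

Lemma lcpC s t : lcp s t = lcp t s.
Proof.
by elim: s t => [|x s IHs] [|y t] //=; rewrite eq_sym; case: eqP => // _; rewrite IHs.
Qed.

Lemma lcp_size s t : (lcp s t <= size s)%N.
Proof. by have := leqnn (lcp s t); rewrite {1}leq_lcp => /andP[]. Qed.

Lemma prefix_lcp s t : prefix s t = (size s <= lcp s t)%N.
Proof.
rewrite prefixE leq_lcp leqnn take_size eq_sym /=.
case: eqP => [/(congr1 size)|]; rewrite ?andbF // size_take andbT.
by case: ifP => ? e; apply/esym; lia.
Qed.

Lemma lcp_take m s t : (m <= lcp s t)%N -> take m s = take m t.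
Proof. by rewrite leq_lcp => /and3P[_ _ /eqP]. Qed.

Lemma lcp_prefix u s t : (size u <= lcp s t)%N -> prefix u s = prefix u t.
Proof. by rewrite !prefixE => /lcp_take ->. Qed.

Lemma leq_lcp_prefix u s t : prefix u s -> prefix u t -> (size u <= lcp s t)%N.
Proof.
move=> us ut; rewrite leq_lcp (size_prefix us) (size_prefix ut).
by move: us ut; rewrite !prefixE => /eqP -> /eqP ->; rewrite eqxx.
Qed.

Lemma leq_lcp_trans m s t u :
  (m <= lcp s t)%N -> (m <= lcp t u)%N -> (m <= lcp s u)%N.
Proof.
by rewrite !leq_lcp => /and3P[-> _ /eqP ->] /and3P[_ -> /eqP ->]; rewrite eqxx.
Qed.

Lemma lcp_rcons s t x y : size s = size t -> s <> t ->
  lcp (rcons s x) (rcons t y) = lcp s t.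
Proof.
elim: s t => [|z s IHs] [|w t] //= [st] nst.
by have [zw|//] := eqVneq z w; rewrite IHs // => e; apply: nst; rewrite zw e.
Qed.

Lemma lcp_lt_size s t : size s = size t -> s <> t -> (lcp s t < size s)%N.
Proof.
move=> st nst; rewrite ltnNge leq_lcp leqnn -st leqnn st take_size.
by rewrite -{1}st take_size; apply/eqP.
Qed.

Lemma sorted_rcons_cat (e : rel T) s x t :
  sorted e (rcons s x ++ t) = sorted e (rcons s x) && path e x t.
Proof. by case: s => //= y s; rewrite cat_path last_rcons. Qed.

End CommonPrefix.

(** * Word metric, outward edges and half-trees of the Cayley tree *)

Section Words.
Local Open Scope group_scope.
Variable S : finType.
Implicit Types (a b c : letter S) (s u v : seq (letter S)) (x y z g h : free_group S).

Definition gen a : free_group S := FreeWord (isT : reduced [:: a]).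

Lemma genV a : gen (linv a) = (gen a)^-1.
Proof. exact: val_inj. Qed.

Lemma linv_neq a : linv a != a.
Proof. by case: a => s []; apply/eqP => -[]. Qed.

Lemma red_cat_id u v : reduced (u ++ v) -> red_cat u v = u ++ v.
Proof.
elim: u => //= a u IHu ruv; rewrite IHu; last exact: path_sorted ruv.
by case: (u ++ v) ruv => //= b w /andP[/negPf ->].
Qed.

Lemma reduced_catl u v : reduced (u ++ v) -> reduced u.
Proof. by move=> /cat_sorted2[]. Qed.

Lemma reduced_prefix u v : prefix u v -> reduced v -> reduced u.
Proof. by move=> /prefixP[w ->]; exact: reduced_catl. Qed.

(** Once the common prefix is cancelled, the remaining words start with different letters, so the
    inverse of one followed by the other is already reduced. *)
Lemma wdist_lcp x y : (wdist x y + 2 * lcp x y = wlen x + wlen y)%N.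
Proof.
rewrite /wdist /wlen /=.
case: x y => [u ru] [v rv] /=; elim: u v ru rv => [|a u IHu] [|b v] ru rv //.
- by rewrite muln0 addn0.
- by rewrite muln0 !addn0 red_cat0 ?word_inv_reduced // /word_inv size_rev size_map.
rewrite [lcp _ _]/=; have [<-|nab] := eqVneq a b.
  have ru' := path_sorted ru; have rv' := path_sorted rv.
  rewrite /word_inv /= rev_cons /red_cat foldr_rcons /= linvK eqxx.
  have := IHu v ru' rv'; rewrite /red_cat /word_inv /=; lia.
rewrite muln0 addn0 red_cat_id.
  by rewrite size_cat /word_inv size_rev size_map.
have := word_inv_reduced ru; rewrite /word_inv /= rev_cons /reduced => r.
by rewrite sorted_rcons_cat r /= linvK eq_sym nab.
Qed.

Lemma wlenV x : wlen x^-1 = wlen x.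
Proof. by rewrite /wlen /= /word_inv size_rev size_map. Qed.

Lemma size_red_cons a s : (size (red_cons a s) <= (size s).+1)%N.
Proof. by case: s => //= b s; case: eqP => //= _; lia. Qed.

Lemma wlenM x y : (wlen (x * y)%g <= wlen x + wlen y)%N.
Proof.
rewrite /wlen /=; elim: (word x) => //= a u IHu.
by apply: leq_trans (size_red_cons _ _) _; rewrite addSn ltnS.
Qed.

Lemma wdistC x y : wdist x y = wdist y x.
Proof. by rewrite /wdist -(wlenV (x^-1 * y)) invgM invgK. Qed.

Lemma wdist_mul z x y : wdist (z * x) (z * y) = wdist x y.
Proof. by rewrite /wdist invgM -mulgA mulKg. Qed.

Lemma wdist_mulr x y : wdist x (x * y) = wlen y.
Proof. by rewrite /wdist mulKg. Qed.

Lemma wlen_wdist x y : (wlen x <= wlen y + wdist x y)%N.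
Proof. by rewrite wdistC -{1}(mulVKg y x) wlenM. Qed.

Lemma wlen0 x : wlen x = 0 -> x = 1.
Proof. by move=> /size0nil x0; exact: val_inj. Qed.

Lemma lcp_wdist m x y : (m + wdist x y <= wlen x)%N -> (m <= lcp x y)%N.
Proof.
move=> mx; have := wdist_lcp x y; have := wlen_wdist x y; lia.
Qed.

Lemma red_cons_word x a :
  word (gen a * x) = red_cons a x.
Proof. by []. Qed.

(** The edge from [x] to [x * gen a] leads away from the vertex 1. *)
Definition outward x a := reduced (rcons x a).

Lemma word_outward x a : outward x a -> word (x * gen a) = rcons x a.
Proof. by rewrite /outward -cats1 => /red_cat_id. Qed.

Lemma wlen_outward x a : outward x a -> wlen (x * gen a) = (wlen x).+1.
Proof. by move=> /word_outward; rewrite /wlen => ->; rewrite size_rcons. Qed.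

Lemma outward_step x a b : outward x a -> b != linv a -> outward (x * gen a) b.
Proof.
move=> xa nb; rewrite /outward (word_outward xa) -cats1 /reduced sorted_rcons_cat.
by move: xa; rewrite /outward /reduced => -> /=; rewrite nb.
Qed.

Lemma word_ind (Q : free_group S -> Prop) : Q 1 ->
  (forall x a, outward x a -> Q x -> Q (x * gen a)) -> forall x, Q x.
Proof.
move=> Q1 QS [w rw]; elim/last_ind: w rw => [|w a IHw] rw.
  by rewrite (_ : FreeWord rw = 1) //; exact: val_inj.
have rw' : reduced w by move: rw; rewrite -cats1 => /reduced_catl.
have wa : outward (FreeWord rw') a by [].
rewrite (_ : FreeWord rw = FreeWord rw' * gen a); first exact/QS/IHw.
by apply: val_inj; rewrite /= -[RHS]/(word (FreeWord rw' * gen a)) (word_outward wa).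
Qed.

Lemma outward_dec x a : outward x a \/
  exists2 y, outward y (linv a) & x = y * gen (linv a).
Proof.
elim/word_ind: x => [|x b xb _]; first by left.
have [->|nab] := eqVneq a (linv b); last by left; exact: outward_step.
by right; exists x; rewrite linvK.
Qed.

Lemma wdist_outward x y a b : wlen x = wlen y -> x <> y ->
  outward x a -> outward y b -> wdist (x * gen a) (y * gen b) = (wdist x y).+2.
Proof.
move=> xy nxy xa yb.
have := wdist_lcp (x * gen a) (y * gen b); have := wdist_lcp x y.
rewrite !wlen_outward // !word_outward // lcp_rcons //; first by lia.
by move=> /val_inj.
Qed.

Lemma wdist_sibling x a b : outward x a -> outward x b -> a != b ->
  wdist (x * gen a) (x * gen b) = 2.
Proof.
move=> xa xb nab; rewrite wdist_mul; have := wdist_lcp (gen a) (gen b).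
by rewrite /= (negPf nab) muln0 addn0.
Qed.

Lemma prefix1E a x : prefix [:: a] x = (ohead x == Some a).
Proof. by case: (word x) => //= b s; rewrite prefix0s andbT eq_sym. Qed.

(** The two half-trees at the edge from 1 to [gen a] are complementary, and translation by the
    inverse of [gen a] carries the half on the side of 1 to the words starting with [linv a]. *)
Lemma prefix1_genV a x : prefix [:: linv a] ((gen a)^-1 * x) = ~~ prefix [:: a] x.
Proof.
rewrite !prefix1E -genV red_cons_word.
case: x => -[|b s] rs /=; first by rewrite eqxx.
rewrite linvK; have [<-|nba] /= := eqVneq b a; last by rewrite eqxx; case: eqP => // -[] /eqP; rewrite (negPf nba).
rewrite eqxx; case: s rs => //= c s /andP[/negPf nc _].
by apply/eqP => -[] /eqP; rewrite nc.
Qed.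

Lemma prefix1_mulV x a y : outward x a ->
  prefix [:: a] (x^-1 * y) = prefix (rcons x a) y.
Proof.
case: x => u ru; rewrite /outward [word _]/= => rua.
elim: u ru rua y => [|b u IHu] ru rua y.
  by rewrite (_ : FreeWord ru = 1) ?invg1 ?mul1g //; exact: val_inj.
have ru' := path_sorted ru; have rua' := path_sorted rua.
have xu : FreeWord ru = gen b * FreeWord ru'.
  by apply: val_inj; rewrite /= -[RHS]/(red_cat [:: b] u) red_cat_id.
rewrite xu invgM -mulgA IHu // -genV red_cons_word.
case: y => -[|c s] rs /=.
  by case: u {IHu ru ru' rua' xu} rua => [|d u] /= /andP[/negPf nb _]; rewrite ?nb.
rewrite linvK; have [_|nbc] //= := eqVneq c b.
by case: u {IHu ru ru' rua' xu} rua => [|d u] /= /andP[/negPf nb _]; rewrite ?nb.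
Qed.

End Words.

(** * Harmonic measure and its energy *)

Section Averages.
Variables (R : realType) (S : finType).
Hypothesis hS : (2 <= #|S|)%N.
Implicit Types (a b c d : letter S) (g h t : free_group S).
Implicit Types (f : free_group S -> R).
Local Open Scope ring_scope.

Definition deg : R := 2 * #|S|%:R.
Definition q : R := (deg - 1)^-1.

Lemma deg_ge4 : 4 <= deg.
Proof.
have : 2 <= #|S|%:R :> R by rewrite (ler_nat _ 2).
rewrite /deg; lra.
Qed.

Lemma deg_ge0 : 0 <= deg.
Proof. have := deg_ge4; lra. Qed.

Lemma deg1_gt0 : 0 < deg - 1.
Proof. have := deg_ge4; lra. Qed.

Lemma q_gt0 : 0 < q.
Proof. by rewrite invr_gt0 deg1_gt0. Qed.

Lemma qn_ge0 n : 0 <= q ^+ n.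
Proof. by rewrite exprn_ge0 // ltW // q_gt0. Qed.

Lemma mulqdeg1 : q * (deg - 1) = 1.
Proof. by rewrite mulVf // gt_eqF // deg1_gt0. Qed.

Lemma mulqdeg : q * deg = 1 + q.
Proof. have := mulqdeg1; rewrite mulrBr mulr1; lra. Qed.

Lemma q_le3 : q <= 3^-1.
Proof. by rewrite lef_pV2 ?posrE ?deg1_gt0 //; have := deg_ge4; lra. Qed.

Lemma deg_neq0 : deg != 0.
Proof. by rewrite gt_eqF //; have := deg_ge4; lra. Qed.

Lemma sum_letter (x : R) : \sum_(d : letter S) x = deg * x.
Proof.
by rewrite sumr_const card_prod card_bool mulnC -mulr_natl natrM.
Qed.

Lemma sum_letterD1 (x : R) c : \sum_(d | d != linv c) x = (deg - 1) * x.
Proof.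
have := sum_letter x; rewrite (bigD1 (linv c)) //= mulrBl mul1r => <-.
by rewrite [x + _]addrC addrK.
Qed.

(** The mean of [f] over the endpoints of the paths without backtracking that cross the edge from
    [h] to [h * gen c] and then make [n] more steps. The edge may point towards 1. *)
Fixpoint avg f n h c : R :=
  if n is n'.+1 then q * \sum_(d | d != linv c) avg f n' (h * gen c)%g d
  else f (h * gen c)%g.

Lemma avg_trans f t n h c :
  avg (fun g => f (t * g)%g) n h c = avg f n (t * h)%g c.
Proof.
elim: n h c => [|n IHn] h c /=; rewrite ?mulgA //.
by congr (_ * _); apply: eq_bigr => d _; rewrite IHn mulgA.
Qed.

Lemma avg_le f f' n h c : (forall g, f g <= f' g) -> avg f n h c <= avg f' n h c.
Proof.
move=> ff'; elim: n h c => [|n IHn] h c //=.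
by rewrite ler_wpM2l ?(ltW q_gt0) //; apply: ler_sum => d _.
Qed.

Lemma avg_cst (x : R) n h c : avg (fun=> x) n h c = x.
Proof.
elim: n h c => [|n IHn] h c //=; under eq_bigr do rewrite IHn.
by rewrite sum_letterD1 mulrA mulqdeg1 mul1r.
Qed.

Lemma avgD f f' n h c :
  avg (fun g => f g + f' g) n h c = avg f n h c + avg f' n h c.
Proof.
elim: n h c => [|n IHn] h c //=; under eq_bigr do rewrite IHn.
by rewrite big_split mulrDr.
Qed.

(* Such an f extends to a locally constant function on the boundary. *)
Definition tame f := exists N, forall g b, (N <= wlen g)%N -> f (g * gen b)%g = f g.

Lemma tame_trans f t : tame f -> tame (fun g => f (t * g)%g).
Proof.
move=> [N fN]; exists (N + wlen t)%N => g b gN; rewrite mulgA fN //.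
have := wlenM (t^-1)%g (t * g)%g; rewrite mulKg wlenV => gt.
by rewrite -(leq_add2l (wlen t)); apply: leq_trans gt; rewrite addnC.
Qed.

Lemma tameD f f' : tame f -> tame f' -> tame (fun g => f g + f' g).
Proof.
move=> [N fN] [N' fN']; exists (maxn N N') => g b; rewrite geq_max => /andP[gN gN'].
by rewrite fN // fN'.
Qed.

Lemma avg_far f N n h c :
    (forall g b, (N <= wlen g)%N -> f (g * gen b)%g = f g) ->
  (N <= (wlen h).+1)%N -> outward h c -> avg f n h c = f (h * gen c)%g.
Proof.
move=> fN; elim: n h c => [|n IHn] h c //= hN hc.
under eq_bigr => d nd.
  rewrite IHn ?wlen_outward ?outward_step //; last by apply: leq_trans hN _.
  rewrite fN ?wlen_outward //; over.
by rewrite sum_letterD1 mulrA mulqdeg1 mul1r.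
Qed.

Lemma avg_stable f N n h c :
    (forall g b, (N <= wlen g)%N -> f (g * gen b)%g = f g) ->
  (N <= (n + wlen h).+1)%N -> outward h c -> avg f n.+1 h c = avg f n h c.
Proof.
move=> fN; elim: n h c => [|n IHn] h c hN hc; first by rewrite !(avg_far _ fN).
rewrite [LHS]/= [RHS]/=; congr (_ * _); apply: eq_bigr => d nd.
by rewrite -IHn ?wlen_outward ?outward_step //; lia.
Qed.

(* For tame f the averages are eventually constant in n; their value is the mean
   of the extension of f over the ends beyond the edge from h to h * gen c. *)
Definition branch f h c : R := xget 0 [set r | \forall n \near \oo, avg f n h c = r].

Lemma avg_near f h c : tame f -> \forall n \near \oo, avg f n h c = branch f h c.
Proof.
move=> /(tame_trans h)[N fN]; rewrite /branch.
case: xgetP => [r _ //|/(_ (avg f N h c)) []].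
exists N => // n /=; elim: n => [|n IHn].
  by rewrite leqn0 => /eqP ->.
rewrite leq_eqVlt => /predU1P[->//|Nn]; rewrite -IHn //.
(* Translating by [h] moves the edge to one issuing from 1, where every letter is outward, as
   [avg_stable] requires. *)
rewrite -[h]mulg1 -!avg_trans; apply: (avg_stable fN) => //; lia.
Qed.

Lemma branch_near f h c r : tame f -> (\forall n \near \oo, avg f n h c = r) -> branch f h c = r.
Proof.
move=> tf nr; have [n [<- <-]] : exists n, avg f n h c = branch f h c /\ avg f n h c = r.
  by near \oo => n; exists n; split; near: n => //; exact: avg_near.
by [].
Unshelve. all: by end_near. Qed.

Lemma branch_far f : tame f -> exists N, forall h c, (N <= wlen h)%N -> outward h c ->
  branch f h c = f (h * gen c)%g.
Proof.
move=> tf; have [N fN] := tf; exists N => h c hN hc; apply: branch_near => //.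
by near=> n; apply: (avg_far _ fN) => //; exact: leqW.
Unshelve. all: by end_near. Qed.

Lemma branch_flow f h c : tame f ->
  branch f h c = q * \sum_(d | d != linv c) branch f (h * gen c)%g d.
Proof.
move=> tf; apply: branch_near => //.
have : \forall n \near \oo, forall d, avg f n (h * gen c)%g d = branch f (h * gen c)%g d.
  by apply: filter_forall => d; exact: avg_near.
move=> [N _ fN]; exists N.+1 => // -[//|n] /= Nn.
by congr (_ * _); apply: eq_bigr => d _; exact: fN.
Qed.

Lemma branch_trans f t h c : branch (fun g => f (t * g)%g) h c = branch f (t * h)%g c.
Proof.
congr (xget 0 _); apply/predeqP => r.
by split=> -[N ? fN]; exists N => // n /fN /=; rewrite avg_trans.
Qed.

Lemma branch_le f f' h c : tame f -> tame f' -> (forall g, f g <= f' g) ->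
  branch f h c <= branch f' h c.
Proof.
move=> tf tf' ff'; near \oo => n.
have <- : avg f n h c = branch f h c by near: n; exact: avg_near.
have <- : avg f' n h c = branch f' h c by near: n; exact: avg_near.
exact: avg_le.
Unshelve. all: by end_near. Qed.

Lemma tame_cst (x : R) : tame (fun=> x).
Proof. by exists 0. Qed.

Lemma branch_cst (x : R) h c : branch (fun=> x) h c = x.
Proof.
by apply: branch_near; [exact: tame_cst | apply: nearW => n; rewrite avg_cst].
Qed.

Lemma branchD f f' h c : tame f -> tame f' ->
  branch (fun g => f g + f' g) h c = branch f h c + branch f' h c.
Proof.
move=> tf tf'; apply: branch_near; first exact: tameD.
near=> n; rewrite avgD; congr (_ + _); near: n; exact: avg_near.
Unshelve. all: by end_near. Qed.

(* The mean of f with respect to the harmonic measure seen from h. *)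
Definition harmonic f h : R := deg^-1 * \sum_c branch f h c.

Lemma harmonic_trans f t h : harmonic (fun g => f (t * g)%g) h = harmonic f (t * h)%g.
Proof. by rewrite /harmonic; under eq_bigr do rewrite branch_trans. Qed.

Lemma harmonic_le f f' h : tame f -> tame f' -> (forall g, f g <= f' g) -> harmonic f h <= harmonic f' h.
Proof.
move=> tf tf' ff'; rewrite ler_wpM2l ?invr_ge0 ?deg_ge0 //.
by apply: ler_sum => c _; exact: branch_le.
Qed.

Lemma harmonicD f f' h : tame f -> tame f' ->
  harmonic (fun g => f g + f' g) h = harmonic f h + harmonic f' h.
Proof.
move=> tf tf'; rewrite /harmonic -mulrDr -big_split; congr (_ * _).
by apply: eq_bigr => c _; exact: branchD.
Qed.

Lemma harmonic_cst (x : R) h : harmonic (fun=> x) h = x.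
Proof.
rewrite /harmonic; under eq_bigr do rewrite branch_cst.
by rewrite sum_letter mulKf // deg_neq0.
Qed.

(** Harnack's inequality for neighbours. By [branch_flow], the ends beyond the edge to [h * gen a]
    contribute equally to both sides, and the others carry the factor q^2 on the left. *)
Lemma harnack f h a : tame f -> (forall g, 0 <= f g) ->
  q * harmonic f (h * gen a)%g <= harmonic f h.
Proof.
move=> tf f0; rewrite /harmonic mulrCA ler_wpM2l ?invr_ge0 ?deg_ge0 //.
have P0 d : 0 <= branch f h d.
  by rewrite -(branch_cst 0 h d); apply: branch_le => //; exact: tame_cst.
rewrite (bigD1 (linv a)) //= mulrDr -branch_flow //.
rewrite [leRHS](bigD1 a) //= [leRHS]addrC lerD2r branch_flow // linvK genV mulgK.
set s := \sum_(i | _) _.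
have s0 : 0 <= s by apply: sumr_ge0.
rewrite mulrA ler_piMl // mulr_ile1 ?ltW ?q_gt0 //; have := q_le3; lra.
Qed.

Fixpoint edges n : seq (free_group S * letter S) :=
  if n is n'.+1 then
    [seq ((e.1 * gen e.2)%g, d) | e <- edges n',
       d <- [seq d <- index_enum (letter S) | d != linv e.2]]
  else [seq (1%g, c) | c <- index_enum (letter S)].

Lemma sum_edges0 (F : free_group S * letter S -> R) :
  \sum_(e <- edges 0) F e = \sum_c F (1%g, c).
Proof. by rewrite big_map. Qed.

Lemma sum_edgesS n (F : free_group S * letter S -> R) :
  \sum_(e <- edges n.+1) F e =
  \sum_(e <- edges n) \sum_(d | d != linv e.2) F ((e.1 * gen e.2)%g, d).
Proof.
by rewrite /= big_allpairs_dep; apply: eq_bigr => e _; rewrite big_filter.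
Qed.

Lemma edgesP n h c : reflect (wlen h = n /\ outward h c) ((h, c) \in edges n).
Proof.
apply: (iffP idP); elim: n h c => [|n IHn] h c.
- by move=> /mapP[d _ [-> ->]].
- move=> /allpairsPdep[[g a] [d [/IHn[<- ga]]]].
  rewrite mem_filter => /andP[nda _] [-> ->].
  by rewrite wlen_outward //; split=> //; exact: outward_step.
- by move=> [/wlen0 -> _]; apply: map_f; rewrite mem_index_enum.
elim/word_ind: h => [|g a ga _]; first by case.
rewrite (wlen_outward ga) => -[[gn] gac]; apply/allpairsPdep.
exists (g, a), c; split=> //; first exact: IHn.
rewrite mem_filter mem_index_enum andbT.
apply/eqP => ca; move: gac; rewrite /outward (word_outward ga) /reduced.
by rewrite -cats1 sorted_rcons_cat ca /= eqxx andbF.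
Qed.

Lemma edges_uniq n : uniq (edges n).
Proof.
elim: n => [|n IHn].
  by rewrite map_inj_uniq ?index_enum_uniq // => a b [].
apply: allpairs_uniq_dep => //; first by move=> e _; rewrite filter_uniq ?index_enum_uniq.
move=> [[g a] b] [[g' a'] b'] /allpairsPdep[[? ?] [? [/edgesP[_ ga] _ /= e1]]].
move=> /allpairsPdep[[? ?] [? [/edgesP[_ ga'] _ /= e2]]].
case: e1 ga => -> -> ->; case: e2 ga' => -> -> -> ga' ga /eqP.
rewrite xpair_eqE => /andP[/eqP/(congr1 (@word S)) + /eqP ->].
by rewrite !word_outward // => /rcons_inj[/val_inj -> ->].
Qed.

(** Steiner's identity, to which the orthogonality arguments below reduce. *)
Lemma parallel_axis (I : finType) (A : pred I) (p : I -> R) (n m z : R) :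
    \sum_(i | A i) 1 = n -> \sum_(i | A i) p i = n * m ->
  \sum_(i | A i) (p i - z) ^+ 2 =
  \sum_(i | A i) (p i - m) ^+ 2 + n * (m - z) ^+ 2.
Proof.
move=> sn sp.
have -> : \sum_(i | A i) (p i - z) ^+ 2 =
    \sum_(i | A i) (p i - m) ^+ 2 + (2 * (m - z)) * (\sum_(i | A i) p i - m * \sum_(i | A i) 1)
      + (m - z) ^+ 2 * \sum_(i | A i) 1.
  rewrite !mulr_sumr -sumrB mulr_sumr -!big_split /=.
  by apply: eq_bigr => i _; lra.
by rewrite sp sn; lra.
Qed.

(** * Martingale increments, Dirichlet energy and Douglas energy of one function *)

Section OneFunction.
Variables (f : free_group S -> R).
Hypothesis tf : tame f.

(** By [branch_flow] the branch means form a martingale along outward paths. These are the sums of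
    the squares of its differences, without the weight [q ^+ n]. *)
Definition increments n : R :=
  if n is n'.+1 then
    \sum_(e <- edges n') \sum_(d | d != linv e.2)
      (branch f (e.1 * gen e.2)%g d - branch f e.1 e.2) ^+ 2
  else \sum_c (branch f 1%g c - harmonic f 1%g) ^+ 2.

(** The difference of the means on the two sides of an edge. It is deg / (deg - 2) times the
    gradient of [harmonic f] along the edge, so [fluxes] measures the Dirichlet energy level by
    level. *)
Definition flux h c : R := branch f h c - branch f (h * gen c)%g (linv c).

Definition fluxes n : R := \sum_(e <- edges n) flux e.1 e.2 ^+ 2.

Lemma children_mean h c :
  \sum_(d | d != linv c) branch f (h * gen c)%g d = (deg - 1) * branch f h c.
Proof. by rewrite (branch_flow h c) // mulrA [_ * q]mulrC mulqdeg1 mul1r. Qed.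

Lemma root_mean : \sum_c branch f 1%g c = deg * harmonic f 1%g.
Proof. by rewrite /harmonic mulVKf ?deg_neq0. Qed.

Lemma children_axis h c z :
  \sum_(d | d != linv c) (branch f (h * gen c)%g d - z) ^+ 2 =
  \sum_(d | d != linv c) (branch f (h * gen c)%g d - branch f h c) ^+ 2
    + (deg - 1) * (branch f h c - z) ^+ 2.
Proof.
by apply: parallel_axis; rewrite ?children_mean // sum_letterD1 mulr1.
Qed.

Lemma root_axis z : \sum_c (branch f 1%g c - z) ^+ 2 = increments 0 + deg * (harmonic f 1%g - z) ^+ 2.
Proof. by apply: parallel_axis; rewrite ?root_mean // sum_letter mulr1. Qed.

(* The two terms are orthogonal when summed over d, which is what makes the
   recurrence fluxesS exact. *)
Lemma flux_step h c d : d != linv c ->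
  flux (h * gen c)%g d = (1 + q) * (branch f (h * gen c)%g d - branch f h c) + q * flux h c.
Proof.
move=> nd; set p := branch f (h * gen c)%g.
have sD1 b : \sum_(i | i != b) p i = \sum_i p i - p b.
  by rewrite [in RHS](bigD1 b) //= [p b + _]addrC addrK.
rewrite /flux -/p (branch_flow h) // (branch_flow (h * gen c * gen d)%g) // linvK genV mulgK.
by rewrite -/p !sD1; lra.
Qed.

Lemma flux_root c : flux 1%g c = (1 + q) * (branch f 1%g c - harmonic f 1%g).
Proof.
have sD1 : \sum_(i | i != c) branch f 1%g i = \sum_i branch f 1%g i - branch f 1%g c.
  by rewrite [in RHS](bigD1 c) //= [branch f 1%g c + _]addrC addrK.
rewrite /flux (branch_flow (1 * gen c)%g) // linvK genV mulgK sD1 root_mean.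
by rewrite mulrBr mulrA mulqdeg; lra.
Qed.

Lemma fluxes0 : fluxes 0 = (1 + q) ^+ 2 * increments 0.
Proof.
by rewrite /fluxes sum_edges0 mulr_sumr; apply: eq_bigr => c _; rewrite flux_root exprMn.
Qed.

Lemma fluxesS n : fluxes n.+1 = (1 + q) ^+ 2 * increments n.+1 + q * fluxes n.
Proof.
rewrite /fluxes sum_edgesS /= !mulr_sumr -big_split; apply: eq_bigr => -[h c] _ /=.
have s1 : \sum_(d | d != linv c) (1 + q) * branch f (h * gen c)%g d
          = (deg - 1) * ((1 + q) * branch f h c).
  by rewrite -mulr_sumr children_mean; lra.
have n1 : \sum_(d | d != linv c) 1 = deg - 1 by rewrite sum_letterD1 mulr1.
(* The base point is chosen so that, by [flux_step], the deviations from it are the fluxes of the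
   child edges. The deviation of the mean is [q * flux h c], and q^2 (deg - 1) = q. *)
have e := parallel_axis ((1 + q) * branch f h c - q * flux h c) n1 s1.
transitivity (\sum_(d | d != linv c) ((1 + q) * branch f (h * gen c)%g d
   - ((1 + q) * branch f h c - q * flux h c)) ^+ 2).
  by apply: eq_bigr => d nd; rewrite flux_step //; congr (_ ^+ 2); lra.
rewrite e mulr_sumr; congr (_ + _); first by apply: eq_bigr => d _; lra.
have -> : q * flux h c ^+ 2 = (q * (deg - 1)) * (q * flux h c ^+ 2) by rewrite mulqdeg1 mul1r.
lra.
Qed.

Lemma increments_ge0 n : 0 <= increments n.
Proof.
case: n => [|n]; first by apply: sumr_ge0 => c _; exact: sqr_ge0.
by apply: sumr_ge0 => e _; apply: sumr_ge0 => c _; exact: sqr_ge0.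
Qed.

Lemma fluxes_ge0 n : 0 <= fluxes n.
Proof. by apply: sumr_ge0 => e _; exact: sqr_ge0. Qed.

Lemma increments_le_fluxes n : increments n <= fluxes n.
Proof.
have q0 := q_gt0; have V0 := increments_ge0 n.
have h : increments n <= (1 + q) ^+ 2 * increments n.
  by rewrite ler_peMl // -[1](expr1n _ 2) ler_sqr ?nnegrE //; lra.
case: n V0 h => [|n] V0 h; rewrite ?fluxes0 // fluxesS; have := fluxes_ge0 n; nra.
Qed.

(** Summing [fluxesS] bounds 1 - q times the left sum by (1 + q)^2 times the sum of increments. As q
    <= 1/3, the ratio is at most 8/3. *)
Lemma sum_fluxes_le n : \sum_(j < n) fluxes j <= 3 * \sum_(j < n) increments j.
Proof.
have q0 := q_gt0; have q3 := q_le3.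
have e m : \sum_(j < m.+1) fluxes j =
    (1 + q) ^+ 2 * \sum_(j < m.+1) increments j + q * \sum_(j < m) fluxes j.
  elim: m => [|m IHm]; first by rewrite !big_ord_recl !big_ord0 mulr0 fluxes0; lra.
  rewrite big_ord_recr /= {1}IHm fluxesS [in RHS]big_ord_recr /= [\sum_(j < m.+1) fluxes j in RHS]big_ord_recr /=.
  lra.
case: n => [|n]; first by rewrite !big_ord0 mulr0.
have := e n; rewrite big_ord_recr /=.
have v0 : 0 <= \sum_(j < n.+1) increments j by apply: sumr_ge0 => j _; exact: increments_ge0.
have w0 : 0 <= \sum_(j < n) fluxes j by apply: sumr_ge0 => j _; exact: fluxes_ge0.
have wn := fluxes_ge0 n.
set v := \sum_(j < n.+1) increments j in v0 *; set w := \sum_(j < n) fluxes j in w0 *.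
move=> ew.
have qw : q * w <= 3^-1 * w by rewrite ler_wpM2r.
have qv : (1 + q) ^+ 2 * v <= (1 + 3^-1) ^+ 2 * v.
  by rewrite ler_wpM2r // ler_sqr ?nnegrE; lra.
lra.
Qed.

(* The mass given by the uniform current to cyl2 x y. *)
Definition theta (x y : free_group S) : R := deg^-1 * q ^+ (wdist x y).-1.

(** Douglas' double integral of (f(x) - f(y))^2 against the uniform current, discretised over pairs
    of cylinders of radius n + 1. The terms with e = e' vanish. *)
Definition energy n : R := \sum_(e <- edges n) \sum_(e' <- edges n)
  theta (e.1 * gen e.2)%g (e'.1 * gen e'.2)%g * (branch f e.1 e.2 - branch f e'.1 e'.2) ^+ 2.

Lemma theta_ge0 x y : 0 <= theta x y.
Proof. by rewrite mulr_ge0 ?invr_ge0 ?exprn_ge0 ?deg_ge0 ?ltW ?q_gt0. Qed.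

Lemma energy0 : 2 / deg * increments 0 <= energy 0.
Proof.
rewrite /energy sum_edges0.
have -> : \sum_c \sum_(e' <- edges 0) theta (1 * gen c)%g (e'.1 * gen e'.2)%g
     * (branch f 1%g c - branch f e'.1 e'.2) ^+ 2
   = \sum_c deg^-1 * q * \sum_d (branch f 1%g d - branch f 1%g c) ^+ 2.
  apply: eq_bigr => c _; rewrite sum_edges0 mulr_sumr; apply: eq_bigr => d _ /=.
  have [<-|nd] := eqVneq c d; first by rewrite !subrr expr0n !mulr0.
  by rewrite /theta wdist_sibling // expr1; lra.
under eq_bigr do rewrite root_axis.
rewrite -mulr_sumr big_split /= sum_letter -mulr_sumr.
have -> : \sum_c (harmonic f 1%g - branch f 1%g c) ^+ 2 = increments 0.
  by apply: eq_bigr => c _; lra.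
have V0 := increments_ge0 0.
have -> : deg^-1 * q * (deg * increments 0 + deg * increments 0) =
    2 / deg * ((q * deg) * increments 0).
  by lra.
rewrite ler_wpM2l ?mulr_ge0 ?invr_ge0 ?deg_ge0 // mulqdeg.
rewrite ler_peMl //; have := q_gt0; lra.
Qed.

(** Refining a pair of distinct cylinders multiplies [theta] by q^2 and creates (deg - 1)^2 pairs,
    so by [children_axis] its contribution does not decrease. A diagonal pair, which contributed 0,
    splits into pairs of siblings that produce the increments. *)
Lemma energyS n : energy n + 2 / deg * increments n.+1 <= energy n.+1.
Proof.
rewrite /energy sum_edgesS.
have -> : 2 / deg * increments n.+1 = \sum_(e <- edges n) \sum_(e' <- edges n)
    if e == e' then 2 / deg * \sum_(d | d != linv e.2)
      (branch f (e.1 * gen e.2)%g d - branch f e.1 e.2) ^+ 2 else 0.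
  rewrite mulr_sumr; apply: eq_big_seq => e en.
  rewrite (bigD1_seq e) ?edges_uniq //= eqxx [X in _ + X]big1 ?addr0 // => e' ne.
  by rewrite eq_sym (negPf ne).
rewrite -big_split /= big_seq [leRHS]big_seq; apply: ler_sum => -[h c] /= hcn.
under [leRHS]eq_bigr do rewrite sum_edgesS.
rewrite [leRHS]exchange_big /= -big_split /= big_seq [leRHS]big_seq.
apply: ler_sum => -[g b] /= gbn; case: eqVneq => [[<- <-]|hcgb].
  rewrite subrr expr0n mulr0 add0r.
  have /edgesP[_ hc] := hcn.
  have -> : \sum_(d | d != linv c) \sum_(d' | d' != linv c)
      theta (h * gen c * gen d)%g (h * gen c * gen d')%g *
        (branch f (h * gen c)%g d - branch f (h * gen c)%g d') ^+ 2
    = \sum_(d | d != linv c) deg^-1 * q * \sum_(d' | d' != linv c)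
        (branch f (h * gen c)%g d' - branch f (h * gen c)%g d) ^+ 2.
    apply: eq_bigr => d nd; rewrite mulr_sumr; apply: eq_bigr => d' nd'.
    have [<-|ndd'] := eqVneq d d'; first by rewrite !subrr expr0n !mulr0.
    by rewrite /theta wdist_sibling ?outward_step // expr1; lra.
  under [leRHS]eq_bigr do rewrite children_axis.
  rewrite -mulr_sumr big_split /= sum_letterD1 -mulr_sumr.
  set v := \sum_(d | d != linv c) (branch f (h * gen c)%g d - branch f h c) ^+ 2.
  have -> : \sum_(d | d != linv c) (branch f h c - branch f (h * gen c)%g d) ^+ 2 = v.
    by apply: eq_bigr => d _; lra.
  have -> : deg^-1 * q * ((deg - 1) * v + (deg - 1) * v)
     = 2 / deg * (q * (deg - 1) * v) by lra.
  by rewrite mulqdeg1 mul1r.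
rewrite addr0.
have /edgesP[hn hc] := hcn; have /edgesP[gn gb] := gbn.
have nhg : (h * gen c <> g * gen b)%g.
  move=> /(congr1 (@word S)); rewrite !word_outward // => /rcons_inj[/val_inj e1 e2].
  by move: hcgb; rewrite e1 e2 eqxx.
have hg : wlen (h * gen c)%g = wlen (g * gen b)%g by rewrite !wlen_outward // hn gn.
have th d d' : d != linv c -> d' != linv b ->
    theta (h * gen c * gen d)%g (g * gen b * gen d')%g
    = q ^+ 2 * theta (h * gen c)%g (g * gen b)%g.
  move=> nd nd'; rewrite /theta wdist_outward ?outward_step //=.
  (* [theta] uses the predecessor of the distance, so the scaling by q^2 needs distinct vertices. *)
  have : wdist (h * gen c)%g (g * gen b)%g <> 0%N.
    by rewrite /wdist => /wlen0 /(congr1 (fun x => h * gen c * x)%g); rewrite mulVKg mulg1 => /esym.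
  by case: (wdist _ _) => // k _; rewrite /= !exprS; lra.
have -> : \sum_(d | d != linv c) \sum_(d' | d' != linv b)
      theta (h * gen c * gen d)%g (g * gen b * gen d')%g *
        (branch f (h * gen c)%g d - branch f (g * gen b)%g d') ^+ 2
  = q ^+ 2 * theta (h * gen c)%g (g * gen b)%g * \sum_(d | d != linv c)
    \sum_(d' | d' != linv b) (branch f (g * gen b)%g d' - branch f (h * gen c)%g d) ^+ 2.
  rewrite mulr_sumr; apply: eq_bigr => d nd; rewrite mulr_sumr; apply: eq_bigr => d' nd'.
  by rewrite th //; lra.
under [X in _ <= _ * X]eq_bigr do rewrite children_axis.
rewrite big_split /= sum_letterD1 -mulr_sumr.
under [X in _ <= _ * (_ + (_ - 1) * X)]eq_bigr do rewrite -sqrrN opprB.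
rewrite (children_axis h c).
set v := \sum_(d | _) _; set w := \sum_(d | d != linv c) _.
have v0 : 0 <= v by apply: sumr_ge0 => d _; exact: sqr_ge0.
have w0 : 0 <= w by apply: sumr_ge0 => d _; exact: sqr_ge0.
rewrite [q ^+ 2 * _]mulrC -[leRHS]mulrA.
rewrite ler_wpM2l ?theta_ge0 //.
set z := (branch f h c - branch f g b) ^+ 2.
have -> : q ^+ 2 * ((deg - 1) * v + (deg - 1) * (w + (deg - 1) * z))
  = q * (q * (deg - 1)) * v + q * (q * (deg - 1)) * w + (q * (deg - 1)) ^+ 2 * z by lra.
rewrite mulqdeg1 !mulr1 expr1n mul1r.
have := q_gt0; nra.
Qed.

Lemma sum_increments_le_energy n : 2 / deg * \sum_(j < n.+1) increments j <= energy n.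
Proof.
elim: n => [|n IHn]; first by rewrite big_ord_recl big_ord0 addr0 energy0.
rewrite big_ord_recr /= mulrDr; apply: le_trans (energyS n).
by rewrite lerD2r.
Qed.

Lemma mean_edges n : q ^+ n * \sum_(e <- edges n) branch f e.1 e.2 = deg * harmonic f 1%g.
Proof.
elim: n => [|n IHn]; first by rewrite expr0 mul1r sum_edges0 root_mean.
rewrite sum_edgesS -IHn exprSr -mulrA; congr (_ * _); rewrite mulr_sumr.
by apply: eq_bigr => e _; rewrite -branch_flow.
Qed.

(** Pythagoras for the martingale of branch means. *)
Lemma second_moment n : q ^+ n * \sum_(e <- edges n) branch f e.1 e.2 ^+ 2 =
  deg * harmonic f 1%g ^+ 2 + \sum_(j < n.+1) q ^+ j * increments j.
Proof.
elim: n => [|n IHn].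
  rewrite big_ord_recl big_ord0 expr0 !mul1r addr0 sum_edges0.
  by have := root_axis 0; rewrite subr0 addrC => <-; apply: eq_bigr => c _; rewrite subr0.
rewrite big_ord_recr /= addrA -IHn sum_edgesS exprSr -!mulrA -mulrDr; congr (_ * _).
rewrite !mulr_sumr -big_split; apply: eq_bigr => -[h c] _ /=.
have := children_axis h c 0; rewrite subr0.
rewrite (eq_bigr (fun d => branch f (h * gen c)%g d ^+ 2)) => [->|d _]; last by rewrite subr0.
by rewrite mulrDr mulrA mulqdeg1 mul1r addrC.
Qed.

(** Far out the branch means are values of [f], that is 0 or 1, so the second moment equals the
    first, which is given by [mean_edges]. *)
Lemma variance : (forall g, f g ^+ 2 = f g) ->
  exists N, forall n, (N <= n)%N ->
    deg * (harmonic f 1%g * (1 - harmonic f 1%g)) = \sum_(j < n.+1) q ^+ j * increments j.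
Proof.
move=> f2; have [N fN] := branch_far tf; exists N => n Nn.
have := second_moment n; rewrite -(@eq_big_seq _ _ _ _ _ (fun e => branch f e.1 e.2)).
  by rewrite mean_edges; lra.
by move=> [h c] /edgesP[hn hc] /=; rewrite fN ?hn // f2.
Qed.

End OneFunction.

(** * Counting the vertices where the variance is large *)

Lemma ler_sum_subset (I : eqType) (s t : seq I) (F : I -> R) :
    uniq s -> {subset s <= t} -> (forall i, 0 <= F i) ->
  \sum_(i <- s) F i <= \sum_(i <- t) F i.
Proof.
move=> + + F0; elim: s t => [|x s IHs] t /=.
  by move=> _ _; rewrite big_nil; apply: sumr_ge0 => i _.
move=> /andP[xs us] st; rewrite big_cons [leRHS](big_rem x) ?st ?mem_head //= lerD2l.
apply: IHs => // y ys; rewrite rem_mem ?st ?inE ?ys ?orbT //.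
by apply: contraNneq xs => <-.
Qed.

Definition edges_upto n := flatten [seq edges j | j <- iota 0 n].

Lemma sum_edges_upto n (F : free_group S * letter S -> R) :
  \sum_(e <- edges_upto n) F e = \sum_(j < n) \sum_(e <- edges j) F e.
Proof.
by rewrite big_flatten big_map -[n in iota 0 n]subn0 big_mkord.
Qed.

Lemma mem_edges_upto n h c :
  ((h, c) \in edges_upto n) = (wlen h < n)%N && outward h c.
Proof.
apply/flattenP/idP => [[s /mapP[j + ->]]|/andP[hn hc]].
  by rewrite mem_iota => /= jn /edgesP[-> ->]; rewrite jn.
exists (edges (wlen h)); last exact/edgesP.
by apply: map_f; rewrite mem_iota.
Qed.

Lemma edges_upto_uniq n : uniq (edges_upto n).
Proof.
elim: n => // n IHn; rewrite /edges_upto -addn1 iotaD map_cat flatten_cat cat_uniq.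
rewrite IHn /= cats0 edges_uniq andbT; apply/hasPn => -[h c] /edgesP[hn _].
by rewrite mem_edges_upto hn ltnn.
Qed.

Lemma card_edges n : q ^+ n * (size (edges n))%:R = deg.
Proof.
have -> : (size (edges n))%:R = \sum_(e <- edges n) 1 :> R.
  by rewrite big_const_seq count_predT iter_addr_0.
elim: n => [|n IHn]; first by rewrite expr0 mul1r sum_edges0 sum_letter mulr1.
rewrite sum_edgesS exprSr -mulrA -[RHS]IHn; congr (_ * _); rewrite mulr_sumr.
by apply: eq_bigr => e _; rewrite sum_letterD1 mulr1 mulqdeg1.
Qed.

Lemma flux_sym f h c : flux f (h * gen c)%g (linv c) = - flux f h c.
Proof. by rewrite /flux linvK genV mulgK opprB. Qed.

Lemma flux_trans f t h c : flux (fun g => f (t * g)%g) h c = flux f (t * h)%g c.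
Proof. by rewrite /flux !branch_trans mulgA. Qed.

Section EnergyBound.
Variables (f : free_group S -> R) (E : R).
Hypothesis tf : tame f.
Hypothesis WE : forall n, \sum_(j < n) fluxes f j <= E.

(** An edge in direction [c] is outward or the reverse of an outward edge, and reversal does not
    change the squared flux. Each of the two kinds costs at most E. *)
Lemma sum_flux_list (T : seq (free_group S)) c : uniq T ->
  \sum_(g <- T) flux f g c ^+ 2 <= 2 * E.
Proof.
move=> uT; have [n Tn] : exists n, forall g, g \in T -> (wlen g < n)%N.
  exists (\max_(g <- T) wlen g).+1 => g gT; rewrite ltnS.
  by rewrite leq_bigmax_seq.
rewrite (bigID (fun g => outward g c)) /= mulr2n mulrDl mul1r; apply: lerD.
  apply: le_trans (WE n); rewrite -sum_edges_upto.
  rewrite -big_filter -(big_map (fun g => (g, c)) xpredT (fun e => flux f e.1 e.2 ^+ 2)).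
  apply: ler_sum_subset => [||e]; last exact: sqr_ge0.
    by rewrite map_inj_uniq ?filter_uniq // => g g' [].
  move=> e /mapP[g + ->]; rewrite mem_filter mem_edges_upto => /andP[-> /Tn ->].
  by [].
have inw g : ~~ outward g c ->
    [/\ outward (g * gen c)%g (linv c), (wlen (g * gen c)%g <= wlen g)%N &
     flux f g c ^+ 2 = flux f (g * gen c)%g (linv c) ^+ 2].
  move=> ngc; rewrite flux_sym sqrrN.
  have [gc|[y yc ->]] := outward_dec g c; first by rewrite gc in ngc.
  by rewrite {1 2}genV mulgVK wlen_outward.
apply: le_trans (WE n); rewrite -sum_edges_upto -big_filter.
rewrite (eq_big_seq (fun g => flux f (g * gen c)%g (linv c) ^+ 2)); last first.
  by move=> g; rewrite mem_filter => /andP[/inw[]].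
rewrite -(big_map (fun g => (g * gen c, linv c)%g) xpredT (fun e => flux f e.1 e.2 ^+ 2)).
apply: ler_sum_subset => [||e]; last exact: sqr_ge0.
  rewrite map_inj_uniq ?filter_uniq // => g g' e.
  by apply: (@mulIg _ (gen c)); exact: (congr1 fst e).
move=> e /mapP[g + ->]; rewrite mem_filter mem_edges_upto => /andP[/inw[-> gg _] /Tn gn].
by rewrite andbT (leq_ltn_trans gg).
Qed.

Lemma sum_fluxes_trans t n : \sum_(j < n) fluxes (fun g => f (t * g)%g) j <= deg * (2 * E).
Proof.
rewrite -(sum_edges_upto n (fun e => flux (fun g => f (t * g)%g) e.1 e.2 ^+ 2)).
under eq_bigr do rewrite flux_trans.
have -> : \sum_(e <- edges_upto n) flux f (t * e.1)%g e.2 ^+ 2 =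
    \sum_c \sum_(e <- edges_upto n | e.2 == c) flux f (t * e.1)%g c ^+ 2.
  rewrite (exchange_big_dep xpredT) //=; apply: eq_bigr => e _.
  by rewrite (big_pred1 e.2) // => c; rewrite /= eq_sym.
rewrite -sum_letter; apply: ler_sum => c _.
rewrite -big_filter -(big_map (fun e => (t * e.1)%g) xpredT (fun g => flux f g c ^+ 2)).
apply: sum_flux_list; rewrite map_inj_in_uniq ?filter_uniq ?edges_upto_uniq //.
move=> [g a] [h b]; rewrite !mem_filter /= => /andP[/eqP -> _] /andP[/eqP -> _].
by move=> /mulgI ->.
Qed.

(** For a fixed edge at level j, its translates by distinct [t] start at distinct vertices and cost
    at most 2E together. There are deg * (deg - 1)^j edges at that level. *)
Lemma fluxes_trans_sum (T : seq (free_group S)) j : uniq T ->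
  q ^+ j * \sum_(t <- T) fluxes (fun g => f (t * g)%g) j <= deg * (2 * E).
Proof.
move=> uT; rewrite -(card_edges j) -mulrA ler_wpM2l ?qn_ge0 //.
have -> : (size (edges j))%:R * (2 * E) = \sum_(e <- edges j) 2 * E.
  by rewrite big_const_seq count_predT iter_addr_0 mulr_natl.
rewrite /fluxes exchange_big /=; apply: ler_sum => e _.
under eq_bigr do rewrite flux_trans.
rewrite -(big_map (fun t => (t * e.1)%g) xpredT (fun g => flux f g e.2 ^+ 2)).
by apply: sum_flux_list; rewrite map_inj_uniq // => g h /mulIg.
Qed.

(* At each [t] the variance of [f] is controlled by the fluxes close to [t],
   up to a geometrically small tail; a given edge is close to few [t]. *)
Lemma size_balanced (T : seq (free_group S)) k r :
    (forall g, f g ^+ 2 = f g) -> uniq T ->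
    (forall t, t \in T -> k <= harmonic f t * (1 - harmonic f t)) ->
    q ^+ r * (2 * E) <= k / 2 ->
  (size T)%:R * (k / 2) <= r%:R * (2 * E).
Proof.
move=> f2 uT kT rE.
have loc t : t \in T ->
    deg * (k / 2) <= \sum_(j < r) q ^+ j * fluxes (fun g => f (t * g)%g) j.
  move=> tT; have [N /(_ (N + r)%N (leq_addr _ _))] :=
    variance (tame_trans t tf) (fun g => f2 (t * g)%g).
  rewrite harmonic_trans mulg1 => eV.
  have := kT t tT; rewrite -(ler_pM2l (lt_le_trans _ deg_ge4 : 0 < deg)) // eV => kV.
  have : deg * k <= \sum_(j < r) q ^+ j * fluxes (fun g => f (t * g)%g) j
      + q ^+ r * (deg * (2 * E)).
    apply: le_trans kV _.
    have -> : ((N + r).+1 = r + N.+1)%N by lia.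
    (* The levels below [r] form the main sum. On the later ones the weight is at most [q ^+ r], and
       the total flux of the translate is bounded by [sum_fluxes_trans]. *)
    rewrite big_split_ord /=; apply: lerD.
      apply: ler_sum => j _; rewrite ler_wpM2l ?qn_ge0 //.
      exact/increments_le_fluxes/tame_trans.
    apply: le_trans (_ : q ^+ r * \sum_(j < N.+1) fluxes (fun g => f (t * g)%g) (r + j)%N <= _).
      rewrite mulr_sumr; apply: ler_sum => j _.
      rewrite exprD -mulrA ler_wpM2l ?qn_ge0 //.
      apply: le_trans (increments_le_fluxes (tame_trans t tf) _).
      rewrite ler_piMl ?increments_ge0 // exprn_ile1 ?ltW ?q_gt0 //; have := q_le3; lra.
    rewrite ler_wpM2l ?qn_ge0 //.
    apply: le_trans (sum_fluxes_trans t (r + N.+1)); rewrite big_split_ord /= lerDr.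
    by apply: sumr_ge0 => j _; exact: fluxes_ge0.
  have : q ^+ r * (deg * (2 * E)) <= deg * (k / 2).
    by rewrite mulrCA ler_wpM2l // deg_ge0.
  lra.
have eT : (size T)%:R * (deg * (k / 2)) = \sum_(t <- T) deg * (k / 2).
  by rewrite big_const_seq count_predT iter_addr_0 mulr_natl.
have er : r%:R * (deg * (2 * E)) = \sum_(j < r) deg * (2 * E).
  by rewrite sumr_const card_ord mulr_natl.
rewrite -(ler_pM2l (lt_le_trans _ deg_ge4 : 0 < deg)) //.
rewrite mulrCA eT [leRHS]mulrCA er.
apply: le_trans (_ : \sum_(t <- T) \sum_(j < r) q ^+ j * fluxes (fun g => f (t * g)%g) j <= _).
  by rewrite big_seq [leRHS]big_seq; apply: ler_sum.
by rewrite exchange_big; apply: ler_sum => j _; rewrite -mulr_sumr fluxes_trans_sum.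
Qed.

End EnergyBound.

(** An inequality form of Douglas' formula: 3 comes from [sum_fluxes_le] and deg / 2 from
    [sum_increments_le_energy]. *)
Lemma sum_fluxes_energy f L : tame f ->
    (exists N, forall n, (N <= n)%N -> energy f n <= L) ->
  forall n, \sum_(j < n) fluxes f j <= 3 * (deg / 2 * L).
Proof.
move=> tf [N fN] n; apply: le_trans (sum_fluxes_le tf n) _; rewrite ler_pM2l //.
have : 2 / deg * \sum_(j < n) increments f j <= L.
  apply: le_trans (fN (N + n)%N (leq_addr _ _)).
  apply: le_trans (sum_increments_le_energy tf (N + n)).
  rewrite ler_wpM2l ?mulr_ge0 ?invr_ge0 ?deg_ge0 //.
  have -> : ((N + n).+1 = n + N.+1)%N by lia.
  by rewrite big_split_ord /= lerDl; apply: sumr_ge0 => j _; exact: increments_ge0.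
rewrite -ler_pdivlMl ?mulr_gt0 ?invr_gt0 //; first by rewrite invf_div.
all: by apply: lt_le_trans deg_ge4.
Qed.

Lemma small_tail (x y : R) : 0 < y -> exists r, q ^+ r * x <= y.
Proof.
move=> y0; have q1 : `|q| < 1.
  by rewrite ger0_norm ?ltW ?q_gt0 //; have := q_le3; lra.
have : (fun r => q ^+ r * x) @ \oo --> (0 * x : R).
  by apply: cvgMl; exact: cvg_expr.
rewrite mul0r => /cvgr0_norm_le /(_ y y0)[r _ /(_ r (leqnn r)) /= ry].
by exists r; apply: le_trans (ler_norm _) ry.
Qed.

Definition bounded_energy (F : letter S -> free_group S -> R) (L : R) :=
  [/\ forall a, tame (F a), forall a g, F a g ^+ 2 = F a g &
      forall a, exists N, forall n, (N <= n)%N -> energy (F a) n <= L].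

(** [size_balanced] is applied to each letter separately. Its bound depends only on [L] and [k],
    hence [B] is uniform in [F]. *)
Lemma count_balanced (L k : R) : 0 < k -> exists B : nat,
  forall F, bounded_energy F L ->
  forall T : seq (free_group S * letter S), uniq T ->
    (forall t a, (t, a) \in T -> k <= harmonic (F a) t * (1 - harmonic (F a) t)) ->
  (size T <= B)%N.
Proof.
move=> k0; set E := 3 * (deg / 2 * L).
have [r rE] := small_tail (2 * E) (divr_gt0 k0 (ltr0n R 2)).
set x := r%:R * (2 * E) / (k / 2).
exists (#|{: letter S}| * (Num.bound `|x|))%N => F [tF F2 FL] T uT kT.
have -> : size T = (\sum_(a : letter S) size [seq e <- T | e.2 == a])%N.
  rewrite -sum1_size; under [RHS]eq_bigr do rewrite -sum1_size big_filter.
  rewrite (exchange_big_dep xpredT) //=; apply: eq_bigr => e _.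
  by rewrite (big_pred1 e.2) // => c; rewrite /= eq_sym.
rewrite -sum_nat_const; apply: leq_sum => a _.
set Ta := [seq e <- T | e.2 == a].
have uTa : uniq [seq e.1 | e <- Ta].
  rewrite map_inj_in_uniq ?filter_uniq // => -[g b] [h c]; rewrite !mem_filter /=.
  by move=> /andP[/eqP -> _] /andP[/eqP -> _] ->.
have := size_balanced (tF a) (sum_fluxes_energy (tF a) (FL a)) (F2 a) uTa _ rE.
rewrite size_map -ler_pdivlMr ?divr_gt0 // -/x => h.
rewrite -(ler_nat R) ltW //; apply: le_lt_trans (h _) _; last first.
  exact: le_lt_trans (ler_norm _) (archi_boundP (normr_ge0 _)).
by move=> t /mapP[[g b]]; rewrite mem_filter /= => /andP[/eqP -> gT] ->; exact: kT.
Qed.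

End Averages.

(** * Automorphisms of bounded energy *)

Section CoarseMaps.
Local Open Scope group_scope.
Variable S : finType.
Implicit Types (a b c : letter S) (f : free_group S -> free_group S).
Implicit Types (x y g h : free_group S).

(** Lipschitz and proper, which in a tree is enough to extend to the boundary; left translations and
    automorphisms both qualify. *)
Definition coarse f :=
  (exists M, forall g b, (wdist (f g) (f (g * gen b)%g) <= M)%N) /\
  (forall n, exists m, forall g, (m <= wlen g)%N -> (n <= wlen (f g))%N).

(** One step moves the image by at most [M]. If the image has length at least n + M, such a move
    cannot alter its first [n] letters. *)
Lemma coarse_prefix_stable f n : coarse f -> exists N, forall u g b, (size u <= n)%N ->
  (N <= wlen g)%N -> prefix u (f (g * gen b)) = prefix u (f g).
Proof.
move=> [[M fM] /(_ (n + M)%N)[N fN]]; exists N => u g b un /fN gN.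
apply/esym/lcp_prefix; apply: leq_trans un _; apply: lcp_wdist.
by apply: leq_trans gN; rewrite leq_add2l.
Qed.

Lemma coarse_mul h : coarse (fun x => h * x).
Proof.
split; first by exists 1%N => g b; rewrite wdist_mul wdist_mulr.
move=> n; exists (n + wlen h)%N => g gn.
have := wlenM h^-1%g (h * g); rewrite mulKg wlenV => gl.
by rewrite -(leq_add2l (wlen h)) addnC; apply: leq_trans gl.
Qed.

(** The left inverse satisfies |f'(x)| <= M |x|, hence |g| <= M |f(g)|. *)
Lemma morph_proper f f' : cancel f f' -> {morph f' : x y / x * y} ->
  forall n, exists m, forall g, (m <= wlen g)%N -> (n <= wlen (f g))%N.
Proof.
move=> ff' f'M; have f'1 : f' 1 = 1.
  by apply: (@mulIg _ (f' 1)); rewrite -f'M !mul1g.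
pose M := \max_(b : letter S) wlen (f' (gen b)).
have f'L x : (wlen (f' x) <= M * wlen x)%N.
  elim/word_ind: x => [|x a xa IHx]; first by rewrite f'1.
  rewrite f'M (wlen_outward xa) mulnS addnC.
  by apply: leq_trans (wlenM _ _) _; apply: leq_add => //; exact: leq_bigmax.
move=> n; exists (M * n).+1 => g gn; rewrite leqNgt; apply/negP => gn'.
have := f'L (f g); rewrite ff' => gM.
by have := leq_trans gn (leq_trans gM (leq_mul (leqnn M) (ltnW gn'))); rewrite ltnn.
Qed.

Lemma morph_coarse f f' : cancel f f' ->
  {morph f : x y / x * y} -> {morph f' : x y / x * y} -> coarse f.
Proof.
move=> ff' fM f'M; split; last exact: morph_proper ff' f'M.
exists (\max_(b : letter S) wlen (f (gen b))) => g b.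
by rewrite fM wdist_mulr; exact: leq_bigmax.
Qed.

End CoarseMaps.

(** * Half-trees pulled back by an automorphism *)

Section Automorphism.
Local Open Scope group_scope.
Variables (S : finType) (Phi : {multiplicative free_group S -> free_group S}).
Implicit Types (a b c : letter S) (x y g h t : free_group S).
Variable Psi : free_group S -> free_group S.
Hypotheses (PhiK : cancel Phi Psi) (PsiK : cancel Psi Phi).

Lemma PhiM x y : Phi (x * y) = Phi x * Phi y.
Proof. exact: gmulfM. Qed.

Lemma PsiM x y : Psi (x * y) = Psi x * Psi y.
Proof. by apply: (can_inj PhiK); rewrite gmulfM !PsiK. Qed.

Lemma Phi1 : Phi 1 = 1.
Proof. by apply: (@mulIg _ (Phi 1)); rewrite -gmulfM !mul1g. Qed.

Lemma Psi1 : Psi 1 = 1.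
Proof. by rewrite -{1}Phi1 PhiK. Qed.

Lemma PhiV x : Phi x^-1 = (Phi x)^-1.
Proof. by apply: (@mulIg _ (Phi x)); rewrite -gmulfM !mulVg Phi1. Qed.

Lemma aut_coarse : coarse Phi.
Proof. exact: morph_coarse PhiK PhiM PsiM. Qed.

Section Balance.
Variable R : realType.
Hypothesis hS : (2 <= #|S|)%N.
Local Open Scope ring_scope.
Let deg : R := deg R S.
Let q : R := q R S.

Definition starts a g : R := (prefix [:: a] (Phi g))%:R.

Definition subtree u t g : R := (prefix u (Phi (t * g)%g))%:R.

Lemma subtree_tame u t : tame (subtree u t).
Proof.
apply: (tame_trans (f := fun g => (prefix u (Phi g))%:R)).
have [N fN] := coarse_prefix_stable (size u) aut_coarse.
by exists N => g b gN; rewrite fN.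
Qed.

Lemma starts_tame a : tame (starts a).
Proof.
have [N fN] := coarse_prefix_stable 1 aut_coarse.
by exists N => g b gN; rewrite /starts fN.
Qed.

Hint Resolve starts_tame subtree_tame : core.

Lemma starts_ge0 a g : 0 <= starts a g.
Proof. exact: ler0n. Qed.

(** [Psi] carries translation by the inverse of [gen a] to the source, and [prefix1_genV] says that
    this translation complements the half-tree. *)
Lemma harmonic_starts_rev a t :
  harmonic (starts (linv a)) (Psi (gen a)^-1 * t)%g = 1 - harmonic (starts a) t.
Proof.
rewrite -harmonic_trans; apply/eqP; rewrite eq_sym subr_eq -harmonicD //; last exact: tame_trans.
rewrite -[X in X == _](harmonic_cst hS 1 t); apply/eqP; congr (harmonic _ t); apply/funext => g.
by rewrite /starts gmulfM PsiK prefix1_genV; case: prefix; rewrite ?addr0 ?add0r.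
Qed.

Lemma harmonic_starts_disjoint a b c t : a != b -> a != c -> b != c ->
  harmonic (starts a) t + harmonic (starts b) t + harmonic (starts c) t <= 1.
Proof.
move=> ab ac bc; rewrite -!harmonicD //; last exact: tameD.
rewrite -[leRHS](harmonic_cst hS 1 t); apply: harmonic_le => //.
- by apply: tameD => //; exact: tameD.
- exact: tame_cst.
move=> g; rewrite /starts; case: (word _) => [|d w] /=; first by rewrite !addr0.
rewrite !prefix0s !andbT.
have [<-|] := eqVneq a d; first by rewrite [b == a]eq_sym (negPf ab) [c == a]eq_sym (negPf ac) !addr0.
have [<-|] := eqVneq b d; first by rewrite [c == b]eq_sym (negPf bc) add0r addr0.
by case: (c == d); rewrite !add0r.
Qed.

(** By [harnack] positivity spreads to neighbours, so one vertex suffices: the preimage of a high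
    power of [a], where every outward branch has mean 1. *)
Lemma harmonic_starts_gt0 a t : 0 < harmonic (starts a) t.
Proof.
have q0 : 0 < q by exact: q_gt0.
have step h b : 0 < harmonic (starts a) h -> 0 < harmonic (starts a) (h * gen b)%g.
  move=> h0; apply: lt_le_trans (harnack hS _ (linv b) (starts_tame a) (starts_ge0 a)).
  by rewrite -mulgA genV mulgV mulg1 mulr_gt0.
suff [h h0] : exists h, 0 < harmonic (starts a) h.
  rewrite -(mulVKg h t); elim/word_ind: (h^-1 * t)%g => [|x b _ IHx].
    by rewrite mulg1.
  by rewrite mulgA step.
have [N1 fN1] := branch_far hS (starts_tame a); have [N2 fN2] := starts_tame a.
have nred m : reduced (nseq m a).
  by case: m => //=; elim=> //= m ->; rewrite eq_sym linv_neq.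
have [n fn] := morph_proper PsiK (@gmulfM _ _ Phi) (maxn N1 N2).
pose h : free_group S := Psi (FreeWord (nred n.+1)).
have [h1 h2] : (N1 <= wlen h /\ N2 <= wlen h)%N.
  by apply/andP; rewrite -geq_max fn // /wlen /= size_nseq leqW.
have ah : starts a h = 1 by rewrite /starts PsiK /= eqxx prefix0s.
have P0 d : 0 <= branch (starts a) h d.
  rewrite -(branch_cst hS 0 h d); apply: branch_le => //; exact: tame_cst.
have [c hc] : exists c, outward h c.
  have [hc|[y yc ->]] := outward_dec h a; first by exists a.
  by exists (linv a); apply: outward_step => //; rewrite eq_sym linv_neq.
exists h; rewrite /harmonic mulr_gt0 ?invr_gt0 //.
  by apply: lt_le_trans (deg_ge4 R hS).
rewrite (bigD1 c) //= ltr_pwDl ?sumr_ge0 //.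
by rewrite fN1 // fN2 // ah.
Qed.

(** Without a maximum, [i0] would start a strictly increasing chain of B + 1 elements at level at
    least [k]. *)
Lemma balance_max (T : eqType) (phi : T -> R) (k : R) (B : nat) (i0 : T) :
    (forall s : seq T, uniq s -> (forall i, i \in s -> k <= phi i) -> (size s <= B)%N) ->
  k <= phi i0 -> exists2 i, k <= phi i & forall j, phi j <= phi i.
Proof.
move=> sB kx0; apply: contrapT => nmax.
have up i : k <= phi i -> exists j, phi i < phi j.
  move=> kx; apply: contrapT => nup; apply: nmax; exists i => // j.
  by rewrite leNgt; apply/negP => xy; apply: nup; exists j.
suff [s [us sz ks]] : exists s : seq T, [/\ uniq s, size s = B.+1 &
    forall i, i \in s -> k <= phi i].
  by have := sB s us ks; rewrite sz ltnn.
suff [i [s [us ss ks _]]] : exists i s, [/\ uniq (i :: s), size s = B,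
    forall j, j \in i :: s -> k <= phi j & forall j, j \in i :: s -> phi j <= phi i].
  by exists (i :: s); split=> //=; rewrite ss.
elim: B {sB} => [|n [i [s [us ss ks xs]]]].
  by exists i0, [::]; split=> // j; rewrite inE => /eqP ->.
have [j xy] := up i (ks i (mem_head _ _)); exists j, (i :: s).
have leys l : l \in i :: s -> phi l < phi j by move=> /xs /le_lt_trans; exact.
split.
- by rewrite cons_uniq us andbT; apply/negP => /leys; rewrite ltxx.
- by rewrite /= ss.
- move=> l; rewrite inE => /predU1P[->|/ks //].
  by apply: le_trans (ltW xy); exact/ks/mem_head.
- by move=> l; rewrite inE => /predU1P[->//|/leys/ltW].
Qed.

(** The centre comes from a pair of a vertex and a letter of maximal variance. The maximum exists
    since each positive level is reached by finitely many pairs. *)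
Lemma energy_center L : bounded_energy starts L ->
  exists t, forall b, harmonic (starts b) t <= 2^-1.
Proof.
move=> FL; have [a0 _] : exists a0 : letter S, True.
  by have /card_gt0P[s _] : (0 < #|S|)%N; [exact: ltnW | exists (s, true)].
pose phi (e : free_group S * letter S) := harmonic (starts e.2) e.1 * (1 - harmonic (starts e.2) e.1).
have phi0 : 0 < phi (1%g, a0).
  by rewrite mulr_gt0 ?harmonic_starts_gt0 // -harmonic_starts_rev harmonic_starts_gt0.
have [B countB] := count_balanced hS L phi0.
have [[t a] _ tmax] := @balance_max _ phi _ B (1%g, a0)
  (fun s us sk => countB starts FL s us (fun t a => sk (t, a))) (lexx _).
(* Looking from the other side of the edge replaces a mass by its complement with the same variance,
   so the maximiser may be taken of mass at most 1/2. *)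
suff [t' [a' [tmax' a'2]]] : exists t' a', (forall e, phi e <= phi (t', a')) /\
    harmonic (starts a') t' <= 2^-1.
  exists t' => b; have [->//|ba] := eqVneq b a'.
  (* A third letter has positive mass. If [b] had mass above 1/2, that mass would lie strictly below
     1 minus the mass of [a'], so its variance would exceed the maximum. *)
  have [c cab] : exists c, c \notin [:: a'; b].
    apply: contrapT => nc; have : (#|{: letter S}| <= size [:: a'; b])%N.
      apply: leq_trans (card_size _); apply: subset_leq_card.
      by apply/fintype.subsetP => c _; apply: contrapT => /negP cab; apply: nc; exists c.
    by rewrite card_prod card_bool => /(leq_trans (leq_mul hS (leqnn 2))).
  move: cab; rewrite !inE negb_or ![c == _]eq_sym => /andP[ac bc].
  have sum1 := harmonic_starts_disjoint t' ba bc ac.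
  have c0 := harmonic_starts_gt0 c t'; have := tmax' (t', b); rewrite /phi /=.
  set x := harmonic _ _ in sum1 a'2 *; set w := harmonic _ _ in sum1 *.
  rewrite leNgt => h; rewrite leNgt; apply: contraNN h; nra.
have [h|h] := lerP (harmonic (starts a) t) 2^-1; first by exists t, a.
exists (Psi (gen a)^-1 * t)%g, (linv a); split; last by rewrite harmonic_starts_rev; lra.
move=> e; apply: le_trans (tmax e) _.
by rewrite /phi /= harmonic_starts_rev; lra.
Qed.

(** Translating by the inverse of [take i u] brings the next edge of the geodesic from 1 to [u] to
    an edge issuing from 1. Through [Psi] this becomes a change of viewpoint in the source. *)
Lemma harmonic_subtree_take u t a0 i (ru : reduced (take i u)) :
    reduced u -> (i < size u)%N ->
  harmonic (subtree (take i.+1 u) t) 1%g =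
  harmonic (starts (nth a0 u i)) ((Psi (FreeWord ru))^-1 * t)%g.
Proof.
move=> redu iu; rewrite -[in RHS](mulg1 (_ * t)%g) -harmonic_trans.
congr (harmonic _ _); apply/funext => g; rewrite /subtree /starts -mulgA.
rewrite (PhiM _ (t * g)%g) PhiV PsiK.
rewrite prefix1_mulV -?(take_nth a0 iu) //.
rewrite /outward -(take_nth a0 iu).
by apply: reduced_prefix redu; apply: prefix_take.
Qed.

Lemma harmonic_subtree_le u v t : prefix u v -> harmonic (subtree v t) 1%g <= harmonic (subtree u t) 1%g.
Proof.
move=> uv; apply: harmonic_le => // g; rewrite /subtree ler_nat.
case: (boolP (prefix v _)) => // vg.
by rewrite (prefix_trans uv vg).
Qed.

(** With [c] the last letter of [w], translation by the inverse of [w] carries the half-tree beyond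
    [w] to the complement of the one beyond [linv c]. Seen from [gen a], its mass is thus at least
    1/2; moving to 1 costs the factor q of [harnack]. *)
Lemma harmonic_subtree_conj t a : (forall b, harmonic (starts b) t <= 2^-1) ->
  let w := Phi (t * gen a * t^-1)%g in
  w != 1%g -> q / 2 <= harmonic (subtree w t) 1%g.
Proof.
move=> Ht w w1.
have [v [c [vc wvc]]] : exists v c, outward v c /\ w = (v * gen c)%g.
  elim/word_ind: (w) w1 => [/eqP//|v c vc _ _]; by exists v, c.
have e g : subtree w t g + starts (linv c) (t * gen (linv a) * g)%g = 1.
  rewrite /subtree /starts.
  have -> : (t * gen (linv a) * g = (t * gen a * t^-1)^-1 * (t * g))%g.
    by rewrite !invgM invgK genV !mulgA mulgVK.
  rewrite (PhiM _ (t * g)%g) PhiV -/w wvc invgM -mulgA prefix1_genV prefix1_mulV //.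
  rewrite -(word_outward vc).
  by case: prefix; rewrite ?addr0 ?add0r.
have := harnack hS 1%g a (subtree_tame w t) (fun g => ler0n _ _).
apply: le_trans; rewrite mul1g ler_wpM2l //; first exact/ltW/q_gt0.
have <- : 1 - harmonic (starts (linv c)) t = harmonic (subtree w t) (gen a).
  have <- : harmonic (fun g => starts (linv c) (t * gen (linv a) * g)%g) (gen a) = harmonic (starts (linv c)) t.
    by rewrite harmonic_trans genV mulgVK.
  apply/eqP; rewrite subr_eq -harmonicD //; last exact: tame_trans.
  rewrite -[X in X == _](harmonic_cst hS 1 (gen a)); apply/eqP; congr (harmonic _ _).
  by apply/funext => g; rewrite e.
have := Ht (linv c); lra.
Qed.

End Balance.
End Automorphism.

(** * Conjugating to make the images of the generators short *)

Section BoundedConjugate.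
Local Open Scope group_scope.

Lemma bounded_conjugate (R : realType) (S : finType) (hS : (2 <= #|S|)%N) (L : R) :
  exists M : nat, forall (Phi : {multiplicative free_group S -> free_group S}),
    bijective Phi -> bounded_energy (starts Phi R) L ->
  exists t, forall a, (wlen (Phi (t * gen a * t^-1)%g) <= M)%N.
Proof.
have q0 := q_gt0 R hS.
have k0 : (0 < q R S / 4)%R by lra.
have [M countM] := count_balanced hS L k0; exists M => Phi [Psi PhiK PsiK] FL.
have [t Ht] := energy_center PhiK PsiK hS FL; exists t => a.
set w := Phi _; have [->//|w1] := eqVneq w 1.
have qw := harmonic_subtree_conj PhiK PsiK hS Ht w1; rewrite -/w in qw.
have red i : reduced (take i w).
  by apply: reduced_prefix (word_reduced w); exact: prefix_take.
(* One pair for each edge of the geodesic from 1 to [w]. The half-trees decrease along it, from mass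
   at most 1/2 at the first edge to at least q/2 at the last, so every variance is at least q/4. *)
pose e i : free_group S * letter S := ((Psi (FreeWord (red i)))^-1 * t, nth a w i).
have := countM _ FL [seq e i | i <- iota 0 (size w)] _ _; rewrite size_map size_iota; apply.
  rewrite map_inj_in_uniq ?iota_uniq // => i j; rewrite !mem_iota /= => iw jw eij.
  have /invg_inj/(can_inj PsiK) := @mulIg _ t _ _ (congr1 fst eij).
  move=> /(congr1 (@word S))/(congr1 size) /=.
  by rewrite !size_take iw jw.
move=> u c /mapP[i]; rewrite mem_iota /= => iw [-> ->].
rewrite -harmonic_subtree_take // ?word_reduced //.
set x := harmonic _ _.
have x1 : (q R S / 2 <= x)%R.
  by apply: le_trans qw _; apply: harmonic_subtree_le => //; exact: prefix_take.
have x2 : (x <= 2^-1)%R.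
  apply: (@le_trans _ _ (harmonic (subtree Phi R (take 1 w) t) 1)).
    by apply: harmonic_subtree_le => //; rewrite -[take 1 w](@take_takel _ 1 i.+1) // prefix_take.
  have w0 : (0 < size w)%N by apply: leq_trans iw.
  rewrite (harmonic_subtree_take PsiK _ _ a (red 0)) ?word_reduced //.
  rewrite (_ : FreeWord (red 0) = 1); last by apply: val_inj; rewrite /= take0.
  by rewrite (Psi1 PhiK) invg1 mul1g.
nra.
Qed.

End BoundedConjugate.

(** * The boundary and the length *)

Section Rays.
Local Open Scope group_scope.
Variable S : finType.
Implicit Types (xi zeta : boundary S) (x y g h : free_group S).
Implicit Types (f : free_group S -> free_group S) (u : nat -> free_group S).

Lemma ray_ext xi zeta : (forall n, xi n = zeta n) -> xi = zeta.
Proof.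
case: xi zeta => [r rr] [s rs] /= /funext e; case: _ / e rs => rs.
by congr Ray; exact: Prop_irrelevance.
Qed.

Lemma take_mkseq (T : Type) (r : nat -> T) m n : (m <= n)%N ->
  take m (mkseq r n) = mkseq r m.
Proof. by move=> mn; rewrite /mkseq -map_take take_iota (minn_idPl mn). Qed.

Lemma prefix_mkseq (T : eqType) (r : nat -> T) m n :
  (m <= n)%N -> prefix (mkseq r m) (mkseq r n).
Proof. by move=> mn; rewrite -(take_mkseq r mn) prefix_take. Qed.

Lemma mkseq_eqP xi zeta n : mkseq xi n = mkseq zeta n <->
  forall i, (i < n)%N -> xi i = zeta i.
Proof.
split=> [e i iN|e]; first by rewrite -(nth_mkseq (xi 0) xi iN) e nth_mkseq.
by apply: (@eq_from_nth _ (xi 0)); rewrite !size_mkseq // => i iN; rewrite !nth_mkseq // e.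
Qed.

Lemma prefix_eq (T : eqType) (s t w : seq T) :
  prefix s w -> prefix t w -> size s = size t -> s = t.
Proof. by rewrite !prefixE => /eqP ps /eqP pt st; rewrite -[LHS]ps -[RHS]pt st. Qed.

Lemma tends_to_unique u xi zeta : tends_to u xi -> tends_to u zeta -> xi = zeta.
Proof.
move=> uxi uzeta; apply: ray_ext => n.
have [k [pxi pzeta]] : exists k, prefix (mkseq xi n.+1) (u k) /\ prefix (mkseq zeta n.+1) (u k).
  by near \oo => k; exists k; split; near: k; [exact: uxi | exact: uzeta].
have := prefix_eq pxi pzeta; rewrite !size_mkseq => /(_ erefl) /mkseq_eqP.
exact.
Unshelve. all: by end_near. Qed.

Lemma wlen_ray_prefix xi n : wlen (ray_prefix xi n) = n.
Proof. by rewrite /wlen /= size_mkseq. Qed.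

Lemma ray_prefix_tends xi : tends_to (ray_prefix xi) xi.
Proof. by move=> m; exists m => // n /= mn; exact: prefix_mkseq. Qed.

Lemma tends_to_bounded u v xi : tends_to u xi ->
  (exists M, forall n, (wdist (u n) (v n) <= M)%N) -> tends_to v xi.
Proof.
move=> uxi [M uvM] m; have [N _ uN] := uxi (m + M)%N.
exists N => // n /uN /= un; rewrite -(@lcp_prefix _ _ (u n)).
  by apply: prefix_trans un; apply: prefix_mkseq; exact: leq_addr.
rewrite size_mkseq; apply: lcp_wdist; have := size_prefix un; rewrite size_mkseq.
by apply: leq_trans; rewrite leq_add2l.
Qed.

Lemma coarse_prefix_ext f n : coarse f -> exists N, forall w x g, (size w <= n)%N ->
  (N <= wlen x)%N -> prefix x g -> prefix w (f g) = prefix w (f x).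
Proof.
move=> cf; have [N fN] := coarse_prefix_stable n cf; exists N => w x g wn xN /prefixP[s].
case: g => v rv /= ev; subst v; elim/last_ind: s rv => [|s b IHs] rv.
  by congr (prefix _ (f _)); apply: val_inj; rewrite /= cats0.
have rv' : reduced (x ++ s).
  by move: rv; rewrite -rcons_cat -cats1 => /reduced_catl.
have gb : outward (FreeWord rv') b by rewrite /outward /= rcons_cat.
rewrite (_ : FreeWord rv = FreeWord rv' * gen b); last first.
  by apply: val_inj; rewrite [LHS]/= -rcons_cat; exact/esym/(word_outward gb).
by rewrite fN // /wlen /= size_cat (leq_trans xN) // leq_addr.
Qed.

(** Beyond a long prefix of [xi] all values of [f] share their first [m] letters. These initial
    words are nested and spell the limit ray. *)
Lemma coarse_limit f xi : coarse f -> exists eta : boundary S,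
  forall m, exists N, forall g, prefix (mkseq xi N) g -> prefix (mkseq eta m) (f g).
Proof.
move=> cf.
have lim m : exists w, size w = m /\ exists N, forall g,
    prefix (mkseq xi N) g -> prefix w (f g).
  have [N fN] := coarse_prefix_ext m cf.
  have [M fM] := cf.2 m.
  (* [M] makes the image at least [m] letters long, and [N] makes those letters stable. *)
  pose w := take m (f (ray_prefix xi (maxn M N))).
  have pw g : prefix (mkseq xi (maxn M N)) g -> prefix w (f g).
    move=> pg; rewrite (fN w (ray_prefix xi (maxn M N))) ?prefix_take //.
      by rewrite size_take; case: ifP => // /negbT; rewrite -leqNgt.
    by rewrite /wlen /= size_mkseq leq_maxr.
  exists w; split; last by exists (maxn M N).
  have : (m <= wlen (f (ray_prefix xi (maxn M N))))%N.
    by apply: fM; rewrite /wlen /= size_mkseq leq_maxl.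
  by rewrite /w size_take leq_eqVlt => /predU1P[->|->//]; rewrite ltnn.
have [W WP] := choice lim.
have Wle m n : (m <= n)%N -> prefix (W m) (W n).
  move=> mn; have [sm [N1 W1]] := WP m; have [sn [N2 W2]] := WP n.
  have p k : (k <= maxn N1 N2)%N -> prefix (mkseq xi k) (ray_prefix xi (maxn N1 N2)).
    exact: prefix_mkseq.
  have := W1 _ (p _ (leq_maxl _ _)); have := W2 _ (p _ (leq_maxr _ _)).
  by rewrite !prefixE sm sn => /eqP <- /eqP <-; rewrite take_takel.
pose r n := nth (xi 0) (W n.+1) n.
have Wr m : W m = mkseq r m.
  apply: (@eq_from_nth _ (xi 0)); rewrite ?size_mkseq (WP m).1 // => i im.
  rewrite nth_mkseq // /r; have := Wle _ _ im; rewrite prefixE (WP i.+1).1 => /eqP <-.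
  by rewrite nth_take.
have rr n : r n.+1 != linv (r n).
  have [_ [N /(_ (ray_prefix xi N) (prefix_refl _))]] := WP n.+2.
  move=> /reduced_prefix/(_ (word_reduced _)); rewrite Wr /reduced.
  move=> /(sortedP (xi 0))/(_ n); rewrite size_mkseq !nth_mkseq //; exact.
exists (Ray rr) => m; have [_ [N WN]] := WP m; exists N => g /WN.
by rewrite Wr.
Qed.

Lemma extendP f xi : coarse f -> forall m, exists N, forall g,
  prefix (mkseq xi N) g -> prefix (mkseq (extend f xi) m) (f g).
Proof.
move=> /(coarse_limit xi)[eta etaP]; suff -> : extend f xi = eta by [].
have lim : tends_to (f \o ray_prefix xi) eta.
  move=> m; have [N etaN] := etaP m; exists N => // n /= Nn.
  exact/etaN/prefix_mkseq.
by apply: xget_unique => // zeta zetaP; exact: tends_to_unique lim.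
Qed.

Lemma extend_tends f u xi : coarse f -> tends_to u xi ->
  tends_to (f \o u) (extend f xi).
Proof.
move=> cf uxi m; have [N fN] := extendP xi cf m; have [M _ uM] := uxi N.
by exists M => // n /uM /fN.
Qed.

Lemma extend_cancel f f' : coarse f -> coarse f' -> cancel f f' ->
  cancel (extend f) (extend f').
Proof.
move=> cf cf' ff' xi; apply: tends_to_unique (ray_prefix_tends xi).
have := extend_tends cf' (extend_tends cf (ray_prefix_tends xi)).
by congr tends_to; apply/funext => n /=; rewrite ff'.
Qed.

End Rays.

(** * Bi-infinite geodesics and their cylinders *)

Section Geodesics.
Local Open Scope group_scope.
Variable S : finType.
Implicit Types (xi zeta : boundary S) (x y g h : free_group S) (p : boundary2 S).
Local Notation src p := (val p).1.
Local Notation tgt p := (val p).2.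

Lemma lcp_ray xi m n : lcp (mkseq xi m) (mkseq xi n) = minn m n.
Proof.
apply/eqP; rewrite eqn_leq; apply/andP; split.
  by rewrite leq_min -{2}(size_mkseq xi m) lcp_size lcpC -{2}(size_mkseq xi n) lcp_size.
rewrite leq_lcp !size_mkseq geq_minl geq_minr !take_mkseq ?geq_minl ?geq_minr //=.
Qed.

Lemma lcp_rays xi zeta j m n : (forall i, (i < j)%N -> xi i = zeta i) ->
  xi j != zeta j -> (j <= m)%N -> (j <= n)%N ->
  lcp (mkseq xi m) (mkseq zeta n) = j.
Proof.
move=> eqj neqj jm jn; apply/eqP; rewrite eqn_leq; apply/andP; split.
  rewrite leqNgt leq_lcp !size_mkseq; apply/negP => /and3P[jm' jn'].
  rewrite !take_mkseq // => /eqP/mkseq_eqP/(_ _ (ltnSn j)) e.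
  by rewrite e eqxx in neqj.
by rewrite leq_lcp !size_mkseq jm jn !take_mkseq //=; apply/eqP/mkseq_eqP.
Qed.

Lemma wdist_ray xi m n : wdist (ray_prefix xi m) (ray_prefix xi n) = `|m%:Z - n%:Z|%N.
Proof.
have := wdist_lcp (ray_prefix xi m) (ray_prefix xi n).
by rewrite /wlen /= !size_mkseq lcp_ray; lia.
Qed.

Lemma wdist_rays xi zeta j m n : (forall i, (i < j)%N -> xi i = zeta i) ->
  xi j != zeta j ->
  wdist (ray_prefix xi (j + m)) (ray_prefix zeta (j + n)) = (m + n)%N.
Proof.
move=> eqj neqj.
have := wdist_lcp (ray_prefix xi (j + m)) (ray_prefix zeta (j + n)).
rewrite /wlen /= !size_mkseq (lcp_rays eqj neqj) ?leq_addr //; lia.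
Qed.

(** Comes in along [xi] to the vertex at depth [j] where the rays part, reached at time 0, and
    leaves along [zeta]. As [Negz m] is -(m + 1), the depth there is j + m + 1. *)
Definition line xi zeta j (n : int) : free_group S :=
  match n with
  | Posz m => ray_prefix zeta (j + m)
  | Negz m => ray_prefix xi (j + m.+1)
  end.

Lemma line_neg xi zeta j n : (forall i, (i < j)%N -> xi i = zeta i) ->
  line xi zeta j (- n%:Z)%R = ray_prefix xi (j + n).
Proof.
case: n => [|n] eqj //; rewrite (_ : - 0%:Z = 0%:Z)%R // /line addn0.
by apply: val_inj; exact/esym/mkseq_eqP.
Qed.

Lemma line_geodesic p j : (forall i, (i < j)%N -> src p i = tgt p i) ->
  src p j != tgt p j -> geodesic_of p (line (src p) (tgt p) j).
Proof.
move=> eqj neqj; split.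
- move=> [m|m] [n|n] /=; rewrite ?wdist_ray; try lia.
    by rewrite wdistC wdist_rays //; lia.
  by rewrite wdist_rays //; lia.
- move=> m; exists m => // n /= mn; rewrite line_neg //.
  by apply: prefix_mkseq; exact: leq_trans mn (leq_addl _ _).
- move=> m; exists m => // n /= mn.
  by apply: prefix_mkseq; exact: leq_trans mn (leq_addl _ _).
Qed.

Lemma branch_point p : exists j, (forall i, (i < j)%N -> src p i = tgt p i) /\
  src p j != tgt p j.
Proof.
have [j neqj] : exists j, src p j != tgt p j.
  apply: contrapT => e; have := set_valP p; rewrite /= => /eqP; apply.
  by apply: ray_ext => n; apply: contrapT => ne; apply: e; exists n; exact/eqP.
have [k nk mink] := ex_minnP (ex_intro (fun j => src p j != tgt p j) j neqj).
exists k; split=> // i ik; apply/eqP; apply: contraTT ik => /mink.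
by rewrite -leqNgt.
Qed.

(** If the first letters agree, two far points of the geodesic share a letter, so their distance is
    less than the sum of their lengths. A passage through 1 between them would force equality. *)
Lemma through1E p : through1 S p <-> src p 0%N != tgt p 0%N.
Proof.
split=> [[gam [geo tsrc ttgt] [s gs]]|neq].
  apply/eqP => e0.
  have [n [sn ps pt]] : exists n : nat, [/\ (`|s| <= n)%N,
      prefix (mkseq (src p) 1) (gam (- n%:Z)%R) & prefix (mkseq (tgt p) 1) (gam n%:Z)].
    near \oo => n; exists n; split; last 2 first.
    - by near: n; exact: tsrc.
    - by near: n; exact: ttgt.
    by near: n; exists `|s|%N.
  have l1 : (0 < lcp (gam (- n%:Z)%R) (gam n%:Z))%N.
    have e1 : mkseq (src p) 1 = mkseq (tgt p) 1 by apply/mkseq_eqP => -[|//] _.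
    by rewrite e1 in ps; exact: leq_lcp_prefix ps pt.
  have := wdist_lcp (gam (- n%:Z)%R) (gam n%:Z).
  have wl m : wlen (gam m) = `|s - m|%N by rewrite -geo gs /wdist invg1 mul1g.
  rewrite geo !wl; lia.
exists (line (src p) (tgt p) 0); first exact: line_geodesic.
by exists 0%R; exact: val_inj.
Unshelve. all: by end_near. Qed.

(** Written with common prefixes, the hypothesis is lcp(x,g) = lcp(x,y) + lcp(y,g) - |y|. Since
    lcp(x,g) is at least the minimum of the other two and lcp(x,y) < |y|, it forces lcp(y,g) >=
    |y|. *)
Lemma prefix_between x y g : wlen x = wlen y -> x <> y ->
  wdist x g = (wdist x y + wdist y g)%N -> prefix y g.
Proof.
move=> xy nxy xyg; have := wdist_lcp x g; have := wdist_lcp y g; have := wdist_lcp x y.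
have := lcp_lt_size xy (fun e => nxy (val_inj e)).
have tr m := @leq_lcp_trans _ m x y g.
rewrite prefix_lcp -/(wlen y) -/(wlen x).
have [|/ltnW h] := leqP (lcp x y) (lcp y g).
  by move=> h; have := tr _ (leqnn _) h; lia.
by have := tr _ h (leqnn _); lia.
Qed.

(** A geodesic through two distinct vertices of equal length moves away from 1 after either end of
    the segment, so the condition splits into one for each end. *)
Lemma cyl2E x y p : wlen x = wlen y -> x <> y ->
  cyl2 x y p <-> cyl x (src p) /\ cyl y (tgt p).
Proof.
move=> xy nxy; split=> [[gam [geo tsrc ttgt] [s [t [st gs gt]]]]|[px py]].
  have [n [sn tn ps pt]] : exists n : nat, [/\ (`|s| <= n)%N, (`|t| <= n)%N,
      prefix (mkseq (src p) (size x)) (gam (- n%:Z)%R) &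
      prefix (mkseq (tgt p) (size y)) (gam n%:Z)].
    near \oo => n; exists n; split.
    - by near: n; exists `|s|%N.
    - by near: n; exists `|t|%N.
    - by near: n; exact: tsrc.
    - by near: n; exact: ttgt.
  have pt' : prefix y (gam n%:Z).
    by apply: (prefix_between xy nxy); rewrite -gs -gt !geo; lia.
  have ps' : prefix x (gam (- n%:Z)%R).
    apply: (@prefix_between y) => //; first by move=> yx; exact: nxy.
    by rewrite -gs -gt !geo; lia.
  by split; [apply: (prefix_eq ps ps') | apply: (prefix_eq pt pt')]; rewrite size_mkseq.
have [j [eqj neqj]] := branch_point p.
have jx : (j < wlen x)%N.
  rewrite ltnNge; apply/negP => xj; apply: nxy; apply: val_inj => /=.
  rewrite -px -py -/(wlen x) -/(wlen y) -xy; apply/mkseq_eqP => i ix.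
  by apply: eqj; exact: leq_trans xj.
exists (line (src p) (tgt p) j); first exact: line_geodesic.
have ej : (j + (wlen x - j) = wlen x)%N by rewrite subnKC // ltnW.
exists (- (wlen x - j)%N%:Z)%R, ((wlen x - j)%N%:Z); split; first by lia.
- by rewrite line_neg //; apply: val_inj; rewrite /= ej.
- by apply: val_inj; rewrite /= ej xy.
Unshelve. all: by end_near. Qed.

Lemma cyl_open x : open (cyl x : set (boundary S)).
Proof. by exists [set x] => //; rewrite bigcup_set1. Qed.

Lemma cyl2_open x y : wlen x = wlen y -> x <> y -> open (cyl2 x y : set (boundary2 S)).
Proof.
move=> xy nxy.
have -> : cyl2 x y = (fun p => src p) @^-1` cyl x `&` (fun p => tgt p) @^-1` cyl y.
  by apply/seteqP; split=> p /(cyl2E p xy nxy).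
apply: openI; apply: open_comp (cyl_open _) => p _.
- apply: (@continuous_comp _ _ _ (val : boundary2 S -> _) fst); last exact: cvg_fst.
  exact: initial_continuous.
- apply: (@continuous_comp _ _ _ (val : boundary2 S -> _) snd); last exact: cvg_snd.
  exact: initial_continuous.
Qed.

Lemma val_diag (f : boundary S -> boundary S) p : injective f ->
  val (diag f p) = (f (src p), f (tgt p)).
Proof.
move=> finj; rewrite val_insubd ifT // inE /=; apply/eqP => /finj.
by have := set_valP p; rewrite /= => /eqP.
Qed.

End Geodesics.

(** * Lengths of automorphisms as finite sums, and their local finiteness *)

Section Length.
Local Open Scope group_scope.
Variables (R : realType) (S : finType) (hS : (2 <= #|S|)%N).
Variable eta : {measure set (borel2 hS) -> \bar R}.
Hypothesis etaP : uniform_current eta.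
Local Notation src p := (val p).1.
Local Notation tgt p := (val p).2.
Implicit Types (Phi : {multiplicative free_group S -> free_group S}).
Implicit Types (x y g h : free_group S).

(** The radius is n + 1: these are the endpoints of the edges over which [energy] sums at level
    [n]. *)
Definition sphere n : seq (free_group S) := [seq e.1 * gen e.2 | e <- edges S n].

Lemma mem_sphere n x : (x \in sphere n) = (wlen x == n.+1).
Proof.
apply/mapP/eqP => [[[h c] /edgesP[hn hc] ->]|].
  by rewrite wlen_outward // hn.
elim/word_ind: x => [//|h c hc _]; rewrite wlen_outward // => -[hn].
by exists (h, c) => //; exact/edgesP.
Qed.

Lemma sphere_uniq n : uniq (sphere n).
Proof.
rewrite map_inj_in_uniq ?edges_uniq // => -[h c] [g b] /edgesP[_ hc] /edgesP[_ gb].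
move=> /(congr1 (@word S)); rewrite !word_outward // => /rcons_inj[/val_inj -> ->].
by [].
Qed.

Definition crossing Phi n : seq (free_group S * free_group S) :=
  [seq p <- [seq (x, y) | x <- sphere n, y <- sphere n] |
     ohead (Phi p.1) != ohead (Phi p.2)].

Lemma crossing_uniq Phi n : uniq (crossing Phi n).
Proof.
rewrite filter_uniq // allpairs_uniq ?sphere_uniq //.
by move=> [x y] [x' y'] _ _ [-> ->].
Qed.

Lemma mem_crossing Phi n x y : ((x, y) \in crossing Phi n) =
  [&& ohead (Phi x) != ohead (Phi y), wlen x == n.+1 & wlen y == n.+1].
Proof.
rewrite mem_filter -!mem_sphere; congr (_ && _).
apply/allpairsP/andP => [[[x' y'] /= [xs ys [-> ->]]]|[xs ys]] //.
by exists (x, y).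
Qed.

Lemma bijective_coarse Phi : bijective Phi -> coarse Phi.
Proof. by move=> [Psi PhiK PsiK]; exact: aut_coarse PhiK PsiK. Qed.

Lemma extend_inj Phi : bijective Phi -> injective (extend Phi).
Proof.
move=> [Psi PhiK PsiK]; apply: (@can_inj _ _ _ (extend Psi)).
have PsM := PsiM PhiK PsiK; have PhM := @gmulfM _ _ Phi.
by apply: extend_cancel => //; [exact: morph_coarse PhiK _ _ | exact: morph_coarse PsiK _ _].
Qed.

Lemma extend_first Phi : bijective Phi -> exists N, forall x xi,
  (N <= wlen x)%N -> cyl x xi -> ohead (Phi x) = Some (extend Phi xi 0%N).
Proof.
move=> /bijective_coarse cPhi; have [N fN] := coarse_prefix_ext 1 cPhi.
exists N => x xi xN xxi; apply/eqP; rewrite -prefix1E.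
have [M fM] := extendP xi cPhi 1.
rewrite -(fN [:: _] x (ray_prefix xi (maxn M (wlen x)))) //.
  exact/fM/prefix_mkseq/leq_maxl.
by rewrite -xxi; exact/prefix_mkseq/leq_maxr.
Qed.

(** By [through1E] only the first letters of the two image rays matter, and by [extend_first] they
    are constant on cylinders of large radius. *)
Lemma aut_length_set Phi : bijective Phi -> exists N, forall n, (N <= n)%N ->
  diag (extend Phi) @^-1` through1 S =
  \bigcup_(p in [set` crossing Phi n]) cyl2 p.1 p.2.
Proof.
move=> bPhi; have [N fN] := extend_first bPhi; exists N => n Nn.
have first k (xi : boundary S) : (n < k)%N ->
    ohead (Phi (ray_prefix xi k)) = Some (extend Phi xi 0%N).
  move=> nk; apply: fN; last by rewrite /cyl /= size_mkseq.
  by rewrite wlen_ray_prefix; apply: leq_trans Nn (ltnW _).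
apply/seteqP; split=> p /=.
  move=> /through1E; rewrite val_diag; last exact: extend_inj.
  move=> /= neq; exists (ray_prefix (src p) n.+1, ray_prefix (tgt p) n.+1).
    rewrite [[set` _] _]/= mem_crossing !first // !wlen_ray_prefix eqxx !andbT.
    by apply: contraNneq neq => -[->].
  apply/cyl2E; rewrite ?wlen_ray_prefix //.
    move=> e; move/eqP: neq; apply; apply: (@Some_inj).
    rewrite -(first n.+1 (src p)) // -(first n.+1 (tgt p)) //.
    exact: (congr1 (fun x => ohead (Phi x)) e).
  by split; rewrite /cyl /mkset -/(wlen _) wlen_ray_prefix.
move=> [[x y]] /=; rewrite mem_crossing => /and3P[neq /eqP xn /eqP yn].
have nxy : x <> y by move=> xy; rewrite xy eqxx in neq.
have xNn : (N <= n.+1)%N by exact: leqW.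
move=> /(cyl2E _ (etrans xn (esym yn)) nxy)[xp yp]; apply/through1E.
rewrite val_diag; last exact: extend_inj.
by apply: contraNneq neq => /= e; rewrite (fN x _ _ xp) ?xn // (fN y _ _ yp) ?yn // e.
Qed.

Lemma cyl2_measurable x y : wlen x = wlen y -> x <> y ->
  measurable (cyl2 x y : set (borel2 hS)).
Proof. by move=> xy nxy; apply: sub_sigma_algebra; exact: cyl2_open. Qed.

Lemma aut_length_measurable Phi : bijective Phi ->
  measurable (diag (extend Phi) @^-1` through1 S : set (borel2 hS)).
Proof.
move=> /aut_length_set[N /(_ N (leqnn N)) ->].
apply: (@fin_bigcup_measurable _ (borel2 hS)); first exact: finite_seq.
move=> [x y] /=; rewrite mem_crossing => /and3P[neq /eqP xn /eqP yn].
apply: cyl2_measurable; first by rewrite xn yn.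
by move=> xy; rewrite xy eqxx in neq.
Qed.

Lemma aut_length_sum Phi : bijective Phi -> exists N, forall n, (N <= n)%N ->
  aut_length eta Phi = (\sum_(p <- crossing Phi n) theta R p.1 p.2)%:E.
Proof.
move=> bPhi; have [N fN] := aut_length_set bPhi; exists N => n /fN.
rewrite /aut_length /current_length /push_current /pushforward => ->.
have sep x y : (x, y) \in crossing Phi n -> wlen x = wlen y /\ x <> y.
  rewrite mem_crossing => /and3P[neq /eqP xn /eqP yn]; rewrite xn yn; split=> // xy.
  by rewrite xy eqxx in neq.
rewrite measure_fin_bigcup; last 3 first.
- exact: finite_seq.
- move=> [x y] [x' y'] /= xy xy' [p [p1 p2]].
  have [] := (cyl2E p (sep _ _ xy).1 (sep _ _ xy).2).1 p1.
  have [] := (cyl2E p (sep _ _ xy').1 (sep _ _ xy').2).1 p2.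
  move: xy xy'; rewrite !mem_crossing => /and3P[_ /eqP xn /eqP yn] /and3P[_ /eqP xn' /eqP yn'].
  rewrite /cyl /= -!/(wlen _) xn yn xn' yn' => ex' ey' ex ey.
  by congr pair; apply: val_inj; [exact: etrans (esym ex) ex' | exact: etrans (esym ey) ey'].
- by move=> [x y] /= /sep[xy nxy]; exact: cyl2_measurable.
rewrite -fsbig_seq ?crossing_uniq // -sumEFin.
apply: eq_big_seq => -[x y] /sep[xy nxy] /=.
rewrite etaP.2; last exact/eqP.
by rewrite /theta /deg /q invfM exprVn.
Qed.

(** At a large level [starts] takes equal values on pairs with the same first image letter, and on
    crossing pairs the squared difference is at most 1. So the energy is at most the sum of
    [aut_length_sum]. *)
Lemma bounded_energy_length Phi L : bijective Phi ->
  (fine (aut_length eta Phi) <= L)%R -> bounded_energy (starts Phi R) L.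
Proof.
move=> bPhi LL; have cPhi := bijective_coarse bPhi.
have tS a : tame (starts Phi R a).
  by have [Psi PhiK PsiK] := bPhi; exact: starts_tame PhiK PsiK _ _.
split=> // [a g|a]; first by rewrite /starts; case: prefix; rewrite ?expr1n ?expr0n.
have [N1 fN1] := aut_length_sum bPhi; have [N2 fN2] := branch_far hS (tS a).
exists (maxn N1 N2) => n; rewrite geq_max => /andP[n1 n2].
apply: le_trans LL; rewrite (fN1 n n1) /= /energy.
have -> : (\sum_(p <- crossing Phi n) theta R p.1 p.2 =
   \sum_(e <- edges S n) \sum_(e' <- edges S n)
    if ohead (Phi (e.1 * gen e.2)%g) != ohead (Phi (e'.1 * gen e'.2)%g) then
     theta R (e.1 * gen e.2)%g (e'.1 * gen e'.2)%g else 0)%R.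
  rewrite big_filter big_mkcond big_allpairs /= big_map; apply: eq_bigr => e _.
  by rewrite big_map.
rewrite big_seq [leRHS]big_seq; apply: ler_sum => -[h c] /edgesP[hn hc] /=.
rewrite big_seq [leRHS]big_seq; apply: ler_sum => -[g b] /edgesP[gn gb] /=.
rewrite !fN2 ?hn ?gn // /starts !prefix1E.
case: (ohead (Phi (h * gen c)%g) =P ohead (Phi (g * gen b)%g)) => [->|_] /=.
  by rewrite subrr expr0n mulr0.
rewrite ler_piMr ?theta_ge0 //.
by do 2 case: (_ == _); rewrite ?subrr ?subr0 ?sub0r ?sqrrN ?expr1n ?expr0n.
Qed.

(** Right multiplication by a fixed element moves vertices a bounded distance and keeps limits, so
    on the boundary conjugation by [t] acts as left translation by [t], which preserves the
    current. *)
Lemma aut_length_conj Phi Phi' t : bijective Phi -> bijective Phi' ->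
  (forall x, Phi' x = Phi (t * x * t^-1)) -> aut_length eta Phi' = aut_length eta Phi.
Proof.
move=> bPhi bPhi' conj.
have ext xi : extend Phi' xi = extend Phi (extend (fun x => t * x) xi).
  apply: tends_to_unique (extend_tends (bijective_coarse bPhi') (ray_prefix_tends xi)) _.
  have tl := extend_tends (coarse_mul t) (ray_prefix_tends xi).
  have tl' : tends_to (fun n => t * ray_prefix xi n * t^-1) (extend (fun x => t * x) xi).
    by apply: tends_to_bounded tl _; exists (wlen t^-1) => n; rewrite wdist_mulr.
  have := extend_tends (bijective_coarse bPhi) tl'.
  by congr tends_to; apply/funext => n /=; rewrite conj.
have tinj : injective (extend (fun x => t * x)).
  apply: (@can_inj _ _ _ (extend (fun x => t^-1 * x))).
  by apply: extend_cancel; [exact: coarse_mul | exact: coarse_mul | exact: mulKg].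
have inv := etaP.1.2 t _ (aut_length_measurable bPhi).
rewrite /aut_length /current_length -[RHS]inv /push_current /pushforward.
congr (eta _); apply/seteqP; split=> p /= /through1E pt; apply/through1E;
  move: pt; rewrite !val_diag ?ext //; exact: extend_inj.
Qed.

(** After a suitable conjugation the images of all letters have length at most [M]. The finite table
    of these images determines the automorphism up to conjugation, hence its length. *)
Lemma lengths_finite L : finite_set
  [set l | exists Phi, [/\ bijective Phi, (fine (aut_length eta Phi) <= L)%R &
     l = fine (aut_length eta Phi)]].
Proof.
have [M MP] := bounded_conjugate hS L.
pose C := {ffun letter S -> M.-bseq (letter S)}.
pose good (k : C) Phi := bijective Phi /\
  exists t, forall a, word (Phi (t * gen a * t^-1)) = k a.
(* The default 0 is taken on tables that come from no automorphism. *)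
pose value (k : C) := xget 0%R [set l | exists2 Phi, good k Phi &
  l = fine (aut_length eta Phi)].
apply: (@sub_finite_set _ _ (value @` setT)); last exact/finite_image/finite_finset.
move=> _ [Phi [bPhi LL ->]].
have [t tM] := MP Phi bPhi (bounded_energy_length bPhi LL).
pose k : C := [ffun a => Bseq (tM a)].
exists k => //; apply: xget_unique; first by exists Phi => //; split=> //; exists t => a; rewrite ffunE.
move=> _ [Phi' [bPhi' [t' t'k]] ->]; congr fine.
have e x : Phi' (t' * x * t'^-1) = Phi (t * x * t^-1).
  have split (f : {multiplicative free_group S -> free_group S}) s y z :
      f (s * (y * z) * s^-1) = f (s * y * s^-1) * f (s * z * s^-1).
    by rewrite -gmulfM; congr (f _); rewrite !mulgA mulgVK.
  elim/word_ind: x => [|x a xa IHx].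
    by rewrite !mulg1 !mulgV !Phi1.
  by rewrite !split IHx; congr (_ * _); apply: val_inj; rewrite /= t'k ffunE.
(* The conjugates by [t'] and [t] agree, so [Phi'] is [Phi] preceded by conjugation by
   [t * t'^-1]. *)
apply: (@aut_length_conj _ _ (t * t'^-1)) => // x.
have := e (t'^-1 * x * t'); rewrite -!mulgA mulVKg mulgV mulg1 => ->.
by rewrite invgM invgK !mulgA.
Qed.

End Length.

Unset Implicit Arguments.

Theorem corollary1p2 (R : realType) (Sigma : finType) (hS : (2 <= #|Sigma|)%N)
    (etaA : {measure set (borel2 hS) -> \bar R}) (hA : uniform_current etaA) :
  (forall Phi, Aut Sigma Phi -> aut_length etaA Phi \is a fin_num) /\
  (let lengths : set R := [set fine (aut_length etaA Phi) | Phi in Aut Sigma] in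
   isolated lengths = lengths).
Proof.
split=> [Phi bPhi|lengths].
  by have [N /(_ N (leqnn N)) ->] := aut_length_sum hA bPhi.
apply/seteqP; split; first exact: isolatedS.
move=> l lA; split; first exact/mem_set.
have fin := lengths_finite hA (l + 1)%R.
set F := [set _ | _] in fin.
(* Only finitely many lengths are at most l + 1. Removing those other than [l] from the open
   half-line leaves a neighbourhood of [l] that isolates it. *)
pose U := [set y | (y < l + 1)%R] `&` ~` (F `\ l).
exists U; last first.
  apply/seteqP; split=> [y [[yl nFy] [Phi bPhi e]]|y ->].
    apply: contrapT => ny; apply: nFy; split => //.
    by exists Phi; split=> //; rewrite e ltW.
  by split=> //; split; [rewrite /= ltrDl | case=> _; apply].
apply: filterI.
  by apply: open_nbhs_nbhs; split; [exact: open_lt | rewrite /= ltrDl].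
apply: open_nbhs_nbhs; split; last by case=> _; apply.
apply: closed_openC; apply: compact_closed; first exact: Rhausdorff.
by apply: finite_compact; apply: sub_finite_set fin => y [].
Qed.
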